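(* Let $p \in [1,2)$ and let $N$ be a counting process with mean function $F(s) = \operatorname{E}(N(s))$, $s \in [0,\infty]$, such that $N(\infty)$ has finite moment of order $p + \varepsilon$ for some $\varepsilon > 0$, i.e. $\operatorname{E}(N(\infty)^{p+\varepsilon}) < \infty$. For each $n \in \mathbb{N}$ let $F_n = n^{-1}\sum_{i=1}^n N_i$ be the average of independent replications $N_1,\dots,N_n$ of $N$ (i.e. independent processes with the same distribution as $N$). Then there exists a constant $C$, depending on $p$ as well as the distribution of $N(\infty)$, such that $$\operatorname{E}\big(\|F_n - F\|_{[p]}\big) \leq C\, n^{\frac{1-p}{p}}$$ for every $n \in \mathbb{N}$.
   Context: A counting process $N$ is a stochastic process indexed by $[0,\infty]$ (each $N(s)$ is a random variable) whose paths take only non-negative integer values, are increasing ($N(t) \ge N(s)$ for $t \ge s$), are right-continuous with left limits, and satisfy $N(0)=0$ and $N(\infty) = \lim_{t\to\infty} N(t)$. For $p \ge 1$ and a real function $f$ on $J = [0,\infty)$, the $p$-variation is $v_p(f) = \sup \sum_{j=1}^m |f(t_j) - f(t_{j-1})|^p$, the supremum being over all $m \in \mathbb{N}$ and all $t_0 < t_1 < \dots < t_m$ in $J$. Put $\|f\|_{(p)} = v_p(f)^{1/p}$, $\|f\|_\infty = \sup_{t \in J}|f(t)|$, and $\|f\|_{[p]} = \|f\|_{(p)} + \|f\|_\infty$ (the $p$-variation norm). *)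

(* Defs.v *)
From HB Require Import structures.
From mathcomp Require Import all_boot all_order all_algebra.
From mathcomp Require Import all_classical all_reals all_analysis.

Set Implicit Arguments.
Unset Strict Implicit.
Unset Printing Implicit Defensive.

Import Order.TTheory GRing.Theory Num.Theory.
Import numFieldNormedType.Exports.

Local Open Scope classical_set_scope.
Local Open Scope ring_scope.

(** A process indexed by [[0, +oo]] is a family [N : \bar R -> {RV P >-> R}] of
    which only the members [N t] with [(0 <= t)%E] are ever constrained or used;
    its values at negative indices are junk. *)

Section variation.
Context {R : realType}.
Implicit Types (p : R) (f : R -> R).

(* Allowing [m = 0], i.e. the empty sum 0, does not affect the supremum. *)
Definition pvar p f : \bar R :=
  ereal_sup [set s : \bar R | exists (m : nat) (t : nat -> R),
    [/\ 0 <= t 0%N,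
        (forall j, (j < m)%N -> t j < t j.+1) &
        s = (\sum_(0 <= j < m) `|f (t j.+1) - f (t j)| `^ p)%:E]].

Definition pvar_seminorm p f : \bar R := (pvar p f `^ p^-1)%E.

Definition sup_norm f : \bar R :=
  ereal_sup [set `|f t|%:E | t in [set t : R | 0 <= t]].

Definition pvar_norm p f : \bar R := (pvar_seminorm p f + sup_norm f)%E.

End variation.

Section process.
Context {d : measure_display} {T : measurableType d} {R : realType}.
Context {P : probability T R}.

Record counting_process (N : \bar R -> {RV P >-> R}) : Prop := {
  counting_nat : forall w t, (0 <= t)%E -> N t w \is a Num.nat ;
  counting_nondecreasing : forall w s t, (0 <= s)%E -> (s <= t)%E ->
    N s w <= N t w ;
  counting_right_continuous : forall w (t : R), 0 <= t ->
    N s%:E w @[s --> t^'+] --> N t%:E w ;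
  counting_left_limit : forall w (t : R), 0 < t ->
    exists l : R, N s%:E w @[s --> t^'-] --> l ;
  counting0 : forall w, N 0%E w = 0 ;
  counting_infty : forall w, N t%:E w @[t --> +oo] --> N +oo%E w }.

(* Finite as soon as [N t] is integrable; [fine] is junk (0) otherwise. *)
Definition mean_function (N : \bar R -> {RV P >-> R}) (t : \bar R) : R :=
  fine 'E_P[N t].

Definition average n (N : 'I_n -> \bar R -> {RV P >-> R}) (t : \bar R) (w : T)
    : R :=
  n%:R^-1 * \sum_(i < n) N i t w.

Definition path_of (N : \bar R -> {RV P >-> R}) (w : T) : \bar R -> R :=
  fun t => N t w.

End process.

(* The product sigma-algebra on path space, generated by the coordinates with
   index in [[0, +oo]]. *)
Definition path_measurable (R : realType) : set (set (\bar R -> R)) :=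
  <<s [set A | exists (t : \bar R) (B : set R),
         [/\ (0 <= t)%E, measurable B & A = [set x | B (x t)]] ]>>.

Definition same_distribution (R : realType)
    (d1 : measure_display) (T1 : measurableType d1) (P1 : probability T1 R)
    (d2 : measure_display) (T2 : measurableType d2) (P2 : probability T2 R)
    (N1 : \bar R -> {RV P1 >-> R}) (N2 : \bar R -> {RV P2 >-> R}) : Prop :=
  forall A, path_measurable A ->
    P1 (path_of N1 @^-1` A) = P2 (path_of N2 @^-1` A).

(* Taking some [A i := setT] gives the product rule for every subfamily. *)
Definition independent_processes (R : realType)
    (d : measure_display) (T : measurableType d) (P : probability T R) (n : nat)
    (N : 'I_n -> \bar R -> {RV P >-> R}) : Prop :=
  forall A : 'I_n -> set (\bar R -> R), (forall i, path_measurable (A i)) ->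
    P (\bigcap_(i in [set: 'I_n]) (path_of (N i) @^-1` A i)) =
    (\prod_(i < n) P (path_of (N i) @^-1` A i))%E.

(* Main.v *)
Require Import Defs.
From HB Require Import structures.
From mathcomp Require Import all_boot all_order all_algebra.
From mathcomp Require Import all_classical all_reals all_analysis.
From mathcomp Require Import measurable_realfun ring lra zify.
Set Implicit Arguments.
Unset Strict Implicit.
Unset Printing Implicit Defensive.
Import Order.TTheory GRing.Theory Num.Theory.
Import numFieldNormedType.Exports.
Local Open Scope classical_set_scope.
Local Open Scope ring_scope.

(** The average of [n] copies is compared with its mean jump by jump. The
    indicator of [{k.+1 <= N t}] is, in [t], a process with a single jump, and [N] is
    the sum of these over [k]. By Minkowski's inequality for the [p]-variation
    it suffices to bound, for each [k], the [p]-variation seminorm of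
    [dev t = #{i | k.+1 <= N_i t} - n * G t], where [G t] is the probability of
    [{k.+1 <= N t}], by a constant times [(n * q) `^ (1 / p)], with [q] a bound of [G].

    One jump ([jump_bound]). Cut time into cells where [n * G] increases by at
    most 1, and merge cells in pairs repeatedly, up to the whole half-line. At
    depth [m] there are about [n * q / 2 ^ m] cells, expecting [2 ^ m] jumps each.
    Choose a representative time in each cell, and telescope [dev] along the
    representatives ([pvar_le_chain]). A link from a cell to its parent is a
    centred binomial variable of variance at most [2 ^ m.+1], so the links of
    depth [m] contribute
    [(n * q / 2 ^ m) `^ (1 / p) * 2 `^ ((m + 1) / 2)] to the [p]-variation
    seminorm. Since [p < 2], this is a convergent geometric series in [m]. Inside a
    finest cell, the variation of [dev] is at most the number of jumps there plus
    their mean, whose second moment is bounded, and the [n * q] finest cells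
    contribute [(n * q) `^ (1 / p)] again. Cells may be separated by large atoms of
    [G]: an increment that leaves a cell is charged to the sizes at both ends
    ([cell_sum_le]), so an atom between two cells costs nothing more.

    Only second moments are computed: [root_le_linear] bounds the seminorm by an
    affine function of [p]-th powers of finitely many deviations, and
    [powR_le_linear] dominates each power by a square at the expected scale. The
    bound is measurable, and its mean is found by linearity.

    Sum over [k] ([pvar_norm_bound]). With [r = p + eps] and [M] a bound for the
    moment of order [r] of the terminal value, [q = M / k.+1 `^ r] by Markov, and
    the terms [(n * q) `^ (1 / p)] are summable with sum of order [n `^ (1 / p)].
    To keep all sums finite, the values above a level [K] depending on [n] are
    split off; their total variation has mean at most
    [2 * n * M / K `^ (r - 1)], at most [2 * M] for [K] large. Division by [n] gives the
    exponent [1 / p - 1]. *)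

(** * Powers and p-variation of real functions *)

Section powers.
Context {R : realType}.
Implicit Types (p x y a s : R).

Lemma powR_superadd p x y : 1 <= p -> 0 <= x -> 0 <= y ->
  x `^ p + y `^ p <= (x + y) `^ p.
Proof.
move=> p1 x0 y0; have p0 : 0 < p by lra.
rewrite -(mulr_powRB1 x0 p0) -(mulr_powRB1 y0 p0) -(mulr_powRB1 (addr_ge0 x0 y0) p0).
by rewrite mulrDl lerD// ler_wpM2l// ge0_ler_powR ?nnegrE//; lra.
Qed.

Lemma powR_add_le p x y : 1 <= p -> p <= 2 -> 0 <= x -> 0 <= y ->
  (x + y) `^ p <= 4 * (x `^ p + y `^ p).
Proof.
move=> p1 p2 x0 y0; wlog xy : x y x0 y0 / x <= y.
  move=> H; have [|/ltW] := leP x y; first exact: H.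
  by rewrite addrC [X in _ <= 4 * X]addrC; exact: H.
apply: (@le_trans _ _ ((2 * y) `^ p)).
  by rewrite ge0_ler_powR ?nnegrE//; lra.
rewrite powRM//; have y1 := powR_ge0 x p; have y2 := powR_ge0 y p.
have h : 2 `^ p <= 4 :> R.
  apply: (@le_trans _ _ (2 `^ 2%:R)); first by rewrite ler_powR//; lra.
  by rewrite powR_mulrn//; lra.
by apply: (@le_trans _ _ (4 * y `^ p)); [rewrite ler_wpM2r | rewrite ler_wpM2l//; lra].
Qed.

(** Trades a power below 2 for a second moment around a chosen scale [s]: when
    [x <= s] the term 1 suffices, otherwise the ratio exceeds 1 and its square
    dominates its [p]-th power. The loss against Lyapunov's inequality is a
    factor 2 in the mean. *)
Lemma powR_le_linear p x s : 1 <= p -> p <= 2 -> 0 <= x -> 0 < s ->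
  x `^ p <= s `^ p * (1 + x ^+ 2 / s ^+ 2).
Proof.
move=> p1 p2 x0 s0.
have -> : x = s * (x / s) by rewrite mulrC divfK// gt_eqF.
set u := x / s; have u0 : 0 <= u by rewrite divr_ge0// ltW.
rewrite powRM//; last exact: ltW.
have -> : (s * u) ^+ 2 / s ^+ 2 = u ^+ 2.
  by rewrite exprMn mulrAC mulfV ?mul1r// expf_eq0/= gt_eqF.
rewrite ler_wpM2l ?powR_ge0//; have [u1|/ltW u1] := leP u 1.
  apply: (@le_trans _ _ (1 `^ p)); first by rewrite ge0_ler_powR ?nnegrE//; lra.
  by rewrite powR1 lerDl sqr_ge0.
rewrite -powR_mulrn//; apply: (@le_trans _ _ (u `^ 2%:R)); first exact: ler_powR.
lra.
Qed.

(** Concavity of the [p]-th root, in a form where [a] is a guess for the size of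
    [y]. It bounds a root by an affine function of [y], so that means of roots
    can be taken by linearity alone, at the cost of a factor 2 when [a] is the
    mean of [y]. *)
Lemma root_le_linear p y a : 1 <= p -> 0 <= y -> 0 < a ->
  y <= (a `^ p^-1 * (1 + y / a)) `^ p.
Proof.
move=> p1 y0 a0; have u0 : 0 <= y / a by rewrite divr_ge0// ltW.
rewrite powRM ?powR_ge0 ?addr_ge0// -powRrM mulVf ?powRr1 ?(ltW a0)//; last first.
  by rewrite gt_eqF//; lra.
have -> : y = a * (y / a) by rewrite mulrC divfK// gt_eqF.
rewrite [a * (y / a) / a]mulrAC mulfV ?mul1r ?gt_eqF// ler_wpM2l ?(ltW a0)//.
apply: (@le_trans _ _ (1 + y / a)); first by lra.
by apply: le1r_powR => //; lra.
Qed.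

Lemma geometric_sum_le x n : 0 <= x -> x < 1 ->
  \sum_(i < n) x ^+ i <= (1 - x)^-1.
Proof.
move=> x0 x1; have d0 : 0 < 1 - x by rewrite subr_gt0.
rewrite -[leRHS]mul1r ler_pdivlMr// mulrC -opprB mulNr -subrX1 opprB.
by rewrite gerBl exprn_ge0.
Qed.

End powers.

Section pvar_bounds.
Context {R : realType}.
Variable p : R.
Implicit Types (f g : R -> R) (A B c : R).

(** An upper bound for the [p]-variation seminorm that stays in the reals; the
    strict positivity of [A] makes division by it harmless. *)
Definition pvar_le f (A : R) := 0 < A /\ (pvar p f <= (A `^ p)%:E)%E.

Lemma pvar_leP f A : 0 < A ->
  (forall (m : nat) (t : nat -> R), 0 <= t 0%N ->
    (forall j, (j < m)%N -> t j < t j.+1) ->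
    \sum_(0 <= j < m) `|f (t j.+1) - f (t j)| `^ p <= A `^ p) ->
  pvar_le f A.
Proof.
move=> A0 H; split=> //; apply: ge_ereal_sup => _ [m [t [t0 tm ->]]].
by rewrite lee_fin; exact: H.
Qed.

Lemma pvar_le_sum f A (m : nat) (t : nat -> R) : pvar_le f A -> 0 <= t 0%N ->
  (forall j, (j < m)%N -> t j < t j.+1) ->
  \sum_(0 <= j < m) `|f (t j.+1) - f (t j)| `^ p <= A `^ p.
Proof.
move=> [A0 H] t0 tm; rewrite -lee_fin; apply: le_trans H.
by apply: ereal_sup_ubound; exists m, t.
Qed.

Lemma partition_ge0 (m : nat) (t : nat -> R) : 0 <= t 0%N ->
  (forall j, (j < m)%N -> t j < t j.+1) -> forall j, (j <= m)%N -> 0 <= t j.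
Proof.
move=> t0 tm; elim=> [//|j IH] jm.
by apply: le_trans (ltW (tm j jm)); apply: IH; exact: ltnW.
Qed.

Lemma pvar_le_ext f g A : (forall t : R, 0 <= t -> f t = g t) ->
  pvar_le f A -> pvar_le g A.
Proof.
move=> fg fA; apply: pvar_leP; first by case: fA.
move=> m t t0 tm; apply: le_trans (@pvar_le_sum _ _ m t fA t0 tm).
rewrite big_nat_cond [leRHS]big_nat_cond; apply: ler_sum => j /andP[/andP[_ jm] _].
by rewrite !fg// (partition_ge0 t0 tm)// ltnW.
Qed.

Lemma pvar_le_cst (p1 : 1 <= p) c A : 0 < A -> pvar_le (fun=> c) A.
Proof.
move=> A0; apply: pvar_leP => // m t _ _.
rewrite big1 ?powR_ge0// => j _; rewrite subrr normr0 powR0//; apply: lt0r_neq0; lra.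
Qed.

Lemma pvar_le_scale f A c : 0 < c -> pvar_le f A -> pvar_le (fun t => c * f t) (c * A).
Proof.
move=> c0 fA; apply: pvar_leP; first by rewrite mulr_gt0//; case: fA.
move=> m t t0 tm; rewrite powRM ?(ltW c0)//; last by case: fA => /ltW.
apply: le_trans (ler_wpM2l (powR_ge0 c p) (@pvar_le_sum _ _ m t fA t0 tm)).
rewrite mulr_sumr ler_sum// => j _.
by rewrite -mulrBr normrM (gtr0_norm c0) powRM// ltW.
Qed.

(** The convexity inequality behind Minkowski: [x / a] and [y / b] are averaged
    with the weights [a / (a + b)] and [b / (a + b)]. *)
Lemma powR_convex2 (p1 : 1 <= p) a b x y : 0 < a -> 0 < b -> 0 <= x -> 0 <= y ->
  (x + y) `^ p <= (a + b) `^ p *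
    (a / (a + b) * (x `^ p / a `^ p) + b / (a + b) * (y `^ p / b `^ p)).
Proof.
move=> a0 b0 x0 y0; have ab0 : 0 < a + b by exact: addr_gt0.
have xE : x = a * (x / a) by rewrite mulrC divfK// gt_eqF.
have yE : y = b * (y / b) by rewrite mulrC divfK// gt_eqF.
have u0 : 0 <= x / a by rewrite divr_ge0// ltW.
have v0 : 0 <= y / b by rewrite divr_ge0// ltW.
have -> : x `^ p / a `^ p = (x / a) `^ p.
  rewrite [in LHS]xE powRM ?(ltW a0)// mulrAC mulfV ?mul1r//.
  by rewrite gt_eqF// powR_gt0.
have -> : y `^ p / b `^ p = (y / b) `^ p.
  rewrite [in LHS]yE powRM ?(ltW b0)// mulrAC mulfV ?mul1r//.
  by rewrite gt_eqF// powR_gt0.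
have -> : x + y = (a + b) * (a / (a + b) * (x / a) + b / (a + b) * (y / b)).
  by field; rewrite !gt_eqF.
have w0 : 0 <= a / (a + b) <= 1.
  by rewrite divr_ge0 ?(ltW a0) ?(ltW ab0)//= ler_pdivrMr// mul1r lerDl ltW.
have w1 : b / (a + b) = 1 - a / (a + b) by field; rewrite gt_eqF.
have wb : 0 <= b / (a + b) by rewrite divr_ge0 ?ltW.
rewrite powRM ?(ltW ab0)//; last by rewrite addr_ge0// mulr_ge0//; case/andP: w0.
rewrite ler_wpM2l ?powR_ge0// w1.
have [w00 w01] := andP w0.
apply: (convex_powR p1 (Itv01 w00 w01) (x := x / a) (y := y / b)) => //=;
by rewrite ?inE/= ?in_itv/= ?andbT.
Qed.

(** Minkowski's inequality over the increments of one partition. *)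
Lemma pvar_leD (p1 : 1 <= p) f g A B : pvar_le f A -> pvar_le g B ->
  pvar_le (fun t => f t + g t) (A + B).
Proof.
move=> fA gB; have [A0 _] := fA; have [B0 _] := gB.
have AB0 : 0 < A + B by exact: addr_gt0.
apply: pvar_leP => // m t t0 tm.
have Sf := @pvar_le_sum _ _ m t fA t0 tm; have Sg := @pvar_le_sum _ _ m t gB t0 tm.
apply: (@le_trans _ _ (\sum_(0 <= j < m) (A + B) `^ p *
   (A / (A + B) * (`|f (t j.+1) - f (t j)| `^ p / A `^ p)
   + B / (A + B) * (`|g (t j.+1) - g (t j)| `^ p / B `^ p)))).
  apply: ler_sum => j _; apply: le_trans (powR_convex2 p1 A0 B0 _ _) => //.
  rewrite ge0_ler_powR ?nnegrE ?addr_ge0//; first lra.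
  have -> : f (t j.+1) + g (t j.+1) - (f (t j) + g (t j)) =
    (f (t j.+1) - f (t j)) + (g (t j.+1) - g (t j)) by ring.
  exact: ler_normD.
rewrite -mulr_sumr ler_piMr ?powR_ge0// big_split/= -!mulr_sumr -!mulr_suml.
have H C S : 0 < C -> S <= C `^ p -> C / (A + B) * (S / C `^ p) <= C / (A + B).
  move=> C0 SC; rewrite ler_piMr//; first by rewrite divr_ge0// ltW.
  by rewrite ler_pdivrMr ?mul1r// powR_gt0.
apply: le_trans (lerD (H _ _ A0 Sf) (H _ _ B0 Sg)) _.
by rewrite -mulrDl mulfV// gt_eqF.
Qed.

Lemma pvar_le_big (p1 : 1 <= p) (n : nat) (f : nat -> R -> R) (A : nat -> R) g B :
  pvar_le g B ->
  (forall k, (k < n)%N -> pvar_le (f k) (A k)) ->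
  pvar_le (fun t => \sum_(k < n) f k t + g t) (\sum_(k < n) A k + B).
Proof.
move=> gB; elim: n => [|n IH] H.
  by rewrite big_ord0 add0r; apply: pvar_le_ext gB => t _; rewrite big_ord0 add0r.
rewrite big_ord_recr/= addrAC.
apply: (@pvar_le_ext (fun t => (\sum_(k < n) f k t + g t) + f n t)).
  by move=> t _; rewrite big_ord_recr/= addrAC.
by apply: (pvar_leD p1); [apply: IH => k kn; apply: H; exact: ltnW | exact: H].
Qed.

(** Since [x `^ p] is superadditive, the [p]-th powers of the increments of [u]
    over a partition add up to at most the [p]-th power of the whole increment:
    total variation dominates [p]-variation. *)
Lemma pvar_le_monotone (p1 : 1 <= p) f (u : R -> R) A : 0 < A ->
  (forall s t : R, 0 <= s -> s <= t -> `|f t - f s| <= u t - u s) ->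
  (forall s t : R, 0 <= s -> s <= t -> u t - u s <= A) ->
  pvar_le f A.
Proof.
move=> A0 fu uA; apply: pvar_leP => // m t t0 tm.
suff [H H'] : t 0%N <= t m /\
    \sum_(0 <= j < m) `|f (t j.+1) - f (t j)| `^ p <= (u (t m) - u (t 0%N)) `^ p.
  apply: le_trans H' _.
  rewrite ge0_ler_powR ?nnegrE ?uA ?(ltW A0)//; first lra.
  by apply: le_trans (fu _ _ t0 H).
elim: m tm => [|m IH] tm; first by rewrite big_nil powR_ge0.
have [|H1 H2] := IH; first by move=> j jm; apply: tm; exact: ltnW.
have tm1 := ltW (tm m (ltnSn m)).
split; first exact: le_trans tm1.
have tm0 : 0 <= t m by exact: le_trans H1.
rewrite big_nat_recr//=.
have -> : u (t m.+1) - u (t 0%N) = (u (t m) - u (t 0%N)) + (u (t m.+1) - u (t m)).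
  by ring.
apply: le_trans (powR_superadd p1 _ _); last 2 first.
- by apply: le_trans (fu _ _ t0 H1).
- by apply: le_trans (fu _ _ tm0 tm1).
apply: lerD => //; rewrite ge0_ler_powR ?nnegrE ?fu//; first lra.
by apply: le_trans (fu _ _ tm0 tm1).
Qed.

(** A function vanishing at 0 has [`|f t| = `|f t - f 0|], one increment, so its
    sup norm is dominated by its [p]-variation seminorm. *)
Lemma pvar_norm_le (p1 : 1 <= p) f A : f 0 = 0 -> pvar_le f A -> (pvar_norm p f <= (2 * A)%:E)%E.
Proof.
move=> f0 fA; have [A0 H] := fA; have pp : 0 < p by lra.
have -> : 2 * A = A + A by ring.
rewrite EFinD; apply: leeD.
  rewrite /pvar_seminorm.
  apply: (@le_trans _ _ (((A `^ p)%:E) `^ p^-1)%E).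
    apply: gt0_ler_poweR => //; rewrite ?invr_ge0 ?(ltW pp)// in_itv/= leey andbT.
    + by apply: ereal_sup_ubound; exists 0%N, (fun=> 0); split => //; rewrite big_nil.
    + by rewrite lee_fin powR_ge0.
  by rewrite poweR_EFin -powRrM mulfV ?gt_eqF// powRr1 ?(ltW A0).
apply: ge_ereal_sup => _ [t /= t0 <-]; rewrite lee_fin.
move: t0; rewrite le_eqVlt => /predU1P[<-|t0]; first by rewrite f0 normr0 ltW.
have /= := @pvar_le_sum f A 1 (fun j => if j is 0%N then 0 else t) fA (lexx _).
have h : forall j, (j < 1)%N -> (if j is 0%N then 0 else t) < t by case.
move=> /(_ h); rewrite big_nat1/= f0 subr0 => H1.
rewrite leNgt; apply/negP => H2; move: H1; rewrite leNgt => /negP; apply.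
by apply: gt0_ltr_powR; rewrite ?nnegrE//; apply: ltW.
Qed.

End pvar_bounds.

(** * Chaining the p-variation through nested cells *)

Section cells.
Context {R : realType}.
Variable p : R.

(** Cut the half-line into consecutive cells, the level sets of [lam]. An increment
    that stays in a cell is charged to the increase of [W] there, whose [p]-th
    powers add up superadditively to at most [w j `^ p]. An increment between two
    cells is charged to the sizes of [h] in both, and each cell is left at most
    once and entered at most once. A cell is thus charged [1 + 4 + 4] times. *)
Lemma cell_sum_le (p1 : 1 <= p) (p2 : p <= 2)
    (lam : R -> nat) (b : nat) (h W : R -> R) (w : nat -> R) :
  (forall s t : R, 0 <= s -> s <= t -> (lam s <= lam t)%N) ->
  (forall t : R, 0 <= t -> (lam t <= b)%N) ->
  (forall j, 0 <= w j) ->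
  (forall t : R, 0 <= t -> `|h t| <= w (lam t)) ->
  (forall s t : R, 0 <= s -> s <= t -> lam s = lam t ->
     `|h t - h s| <= W t - W s /\ W t - W s <= w (lam t)) ->
  forall (m : nat) (t : nat -> R), 0 <= t 0%N ->
    (forall j, (j < m)%N -> t j < t j.+1) ->
    \sum_(0 <= j < m) `|h (t j.+1) - h (t j)| `^ p
    <= 9 * \sum_(0 <= i < b.+1) w i `^ p.
Proof.
move=> lam_nd lam_b w0 hw hW m t t0 tm.
have wp0 i : 0 <= w i `^ p by exact: powR_ge0.
have pp : 0 <= p by lra.
have sum_nd i j : (i <= j)%N ->
    \sum_(0 <= i < i) w i `^ p <= \sum_(0 <= i < j) w i `^ p.
  by move=> ij; rewrite (@big_cat_nat _ _ _ i 0 j)//= lerDl sumr_ge0.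
(* Invariant: [s] is the first partition point in the cell of [t m]; that cell
   has been charged for its entry, not yet for its exit, while the increase of
   [W] inside it is still running. *)
suff [s [s0 st ls S]] : exists s, [/\ 0 <= s, s <= t m, lam s = lam (t m) &
    \sum_(0 <= j < m) `|h (t j.+1) - h (t j)| `^ p <=
    9 * (\sum_(0 <= i < lam (t m)) w i `^ p) + 4 * w (lam (t m)) `^ p
    + (W (t m) - W s) `^ p].
  have [_ Ww] := hW _ _ s0 st ls.
  have Wp : (W (t m) - W s) `^ p <= w (lam (t m)) `^ p.
    rewrite ge0_ler_powR ?nnegrE//.
    by have [+ _] := hW _ _ s0 st ls; exact: le_trans.
  apply: (@le_trans _ _ (9 * \sum_(0 <= i < (lam (t m)).+1) w i `^ p)).
    by rewrite big_nat_recr//=; have := wp0 (lam (t m)); lra.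
  by rewrite ler_wpM2l// sum_nd// ltnS lam_b// (partition_ge0 t0 tm).
elim: m tm => [|m IH] tm.
  exists (t 0%N); split=> //; rewrite big_nil subrr powR0; last by rewrite gt_eqF//; lra.
  by rewrite addr0 addr_ge0// mulr_ge0// sumr_ge0.
have [|s [s0 st ls S]] := IH; first by move=> j jm; apply: tm; exact: ltnW.
have tm1 := ltW (tm m (ltnSn m)).
have tm0 : 0 <= t m by exact: le_trans st.
have tm10 : 0 <= t m.+1 by exact: le_trans tm1.
have [hs Ws] := hW _ _ s0 st ls.
have Ws0 : 0 <= W (t m) - W s by exact: le_trans hs.
rewrite big_nat_recr//=.
have := lam_nd _ _ tm0 tm1; rewrite leq_eqVlt => /predU1P[le|lt].
  exists s; split=> //; [exact: le_trans tm1 | by rewrite ls le | ].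
  have [ht Wt] := hW _ _ tm0 tm1 le.
  have Wt0 : 0 <= W (t m.+1) - W (t m) by exact: le_trans ht.
  have -> : W (t m.+1) - W s = (W (t m) - W s) + (W (t m.+1) - W (t m)) by ring.
  have := powR_superadd p1 Ws0 Wt0.
  have : `|h (t m.+1) - h (t m)| `^ p <= (W (t m.+1) - W (t m)) `^ p.
    by rewrite ge0_ler_powR ?nnegrE.
  by rewrite -le; lra.
exists (t m.+1); split=> //.
rewrite subrr powR0 ?addr0; last by rewrite gt_eqF//; lra.
have c1 : `|h (t m.+1) - h (t m)| `^ p <=
    4 * (w (lam (t m.+1)) `^ p + w (lam (t m)) `^ p).
  apply: le_trans (powR_add_le p1 p2 (w0 _) (w0 _)).
  rewrite ge0_ler_powR ?nnegrE ?addr_ge0//.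
  by apply: le_trans (ler_normB _ _) _; rewrite lerD// hw.
have c2 : (W (t m) - W s) `^ p <= w (lam (t m)) `^ p.
  by rewrite ge0_ler_powR ?nnegrE.
have := sum_nd _ _ lt; rewrite big_nat_recr//= => c3.
lra.
Qed.

Lemma pvar_le_cells (p1 : 1 <= p) (p2 : p <= 2)
    (lam : R -> nat) (b : nat) (h W : R -> R) (w : nat -> R) a :
  0 < a ->
  (forall s t : R, 0 <= s -> s <= t -> (lam s <= lam t)%N) ->
  (forall t : R, 0 <= t -> (lam t <= b)%N) ->
  (forall j, 0 <= w j) ->
  (forall t : R, 0 <= t -> `|h t| <= w (lam t)) ->
  (forall s t : R, 0 <= s -> s <= t -> lam s = lam t ->
     `|h t - h s| <= W t - W s /\ W t - W s <= w (lam t)) ->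
  pvar_le p h (a `^ p^-1 * (1 + 9 * (\sum_(0 <= i < b.+1) w i `^ p) / a)).
Proof.
move=> a0 lam_nd lam_b w0 hw hW.
have Y0 : 0 <= 9 * (\sum_(0 <= i < b.+1) w i `^ p).
  by rewrite mulr_ge0// sumr_ge0// => i _; exact: powR_ge0.
apply: pvar_leP.
  by rewrite mulr_gt0 ?powR_gt0// ltr_wpDr// divr_ge0// ltW.
move=> m t t0 tm; apply: le_trans (root_le_linear p1 Y0 a0).
exact: (@cell_sum_le p1 p2 lam b h W w).
Qed.

Section chain.
Variables (lam : R -> nat) (b : nat).
Hypothesis lam_nd : forall s t : R, 0 <= s -> s <= t -> (lam s <= lam t)%N.
Hypothesis lam_b : forall t : R, 0 <= t -> (lam t <= b)%N.

(** Halving [lam] repeatedly merges neighbouring cells in pairs, so the cells of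
    depth [m.+1] are unions of cells of depth [m]: coarser as [m] grows. *)
Definition cell (m j : nat) : set R := [set t | 0 <= t /\ (lam t %/ 2 ^ m)%N = j].
Definition rep (m j : nat) : R := xget 0 (cell m j).

Lemma rep_cell m t : 0 <= t -> cell m (lam t %/ 2 ^ m) (rep m (lam t %/ 2 ^ m)).
Proof. by move=> t0; apply: (@xgetPex _ 0); exists t. Qed.

Lemma cell_parent m j t : cell m j t -> cell m.+1 (j %/ 2) t.
Proof. by move=> [t0 <-]; split=> //; rewrite expnSr divnMA. Qed.

Lemma rep_in_cell m j : cell m j !=set0 -> cell m j (rep m j).
Proof. by move=> ex; exact: xgetPex. Qed.

(** The jump of [f] from the representative of a cell to the one of its parent. An
    empty cell has a default representative, possibly far from its parent's,
    hence the test. *)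
Definition chain_step (f : R -> R) m j : R :=
  if `[< cell m j !=set0 >] then `|f (rep m j) - f (rep m.+1 (j %/ 2))| else 0.

Lemma chain_step_ge0 f m j : 0 <= chain_step f m j.
Proof. by rewrite /chain_step; case: ifP. Qed.

(** Chaining: with [r m t] the representative of the cell of depth [m] around [t],
    [f] is [f - f \o r 0], plus the links [f \o r m - f \o r m.+1], plus
    [f \o r M], which is constant because a single cell is left at depth [M].
    A link is constant on the cells of depth [m], so only finitely many values
    of [f] matter. The part below depth 0 is controlled by the variation [W]
    inside the finest cells. The free parameters [a m] and [a0] are the guesses
    of [root_le_linear]. *)
Lemma pvar_le_chain (p1 : 1 <= p) (p2 : p <= 2)
    (f W : R -> R) (v : nat -> R) (M : nat) (a0 : R)
    (a : nat -> R) :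
  (b < 2 ^ M)%N -> 0 < a0 -> (forall m, 0 < a m) -> (forall j, 0 <= v j) ->
  (forall s t : R, 0 <= s -> s <= t -> `|f t - f s| <= W t - W s) ->
  (forall s t j, cell 0 j s -> cell 0 j t -> s <= t -> W t - W s <= v j) ->
  pvar_le p f
    (\sum_(m < M) (a m `^ p^-1 *
       (1 + 9 * (\sum_(0 <= j < (b %/ 2 ^ m).+1) chain_step f m j `^ p) / a m))
     + (a0 `^ p^-1 * (1 + 9 * (\sum_(0 <= j < b.+1) v j `^ p) / a0) + a0 `^ p^-1)).
Proof.
move=> bM a00 am0 v0 fW Wv.
pose r m t := rep m (lam t %/ 2 ^ m).
have pa0 : 0 < a0 `^ p^-1 by rewrite powR_gt0.
apply: (@pvar_le_ext _ p (fun t => \sum_(m < M) (f (r m t) - f (r m.+1 t)) +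
   ((f t - f (r 0 t)) + f (rep M 0)))).
  move=> t t0; have -> : rep M 0 = r M t.
    by rewrite /r divn_small//; exact: leq_ltn_trans (lam_b t0) bM.
  rewrite -(big_mkord xpredT (fun m => f (r m t) - f (r m.+1 t))).
  have -> : \sum_(0 <= m < M) (f (r m t) - f (r m.+1 t)) = f (r 0%N t) - f (r M t).
    rewrite -[RHS]opprB -(telescope_sumr (fun m => f (r m t)) (leq0n M)) -sumrN.
    by apply: eq_bigr => m _; rewrite opprB.
  ring.
apply: (@pvar_le_big _ p p1 M (fun m t => f (r m t) - f (r m.+1 t))
   (fun m => a m `^ p^-1 *
       (1 + 9 * (\sum_(0 <= j < (b %/ 2 ^ m).+1) chain_step f m j `^ p) / a m))).
  apply: pvar_leD => //; last exact: pvar_le_cst.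
  apply: (@pvar_le_cells p1 p2 lam b _ W v) => //.
  - move=> t t0; have [r0 rl] := rep_cell 0 t0.
    rewrite -/(r 0%N t) in r0 rl *; rewrite !expn0 !divn1 in rl.
    have [rt|/ltW rt] := leP (r 0%N t) t.
      apply: le_trans (fW _ _ r0 rt) _; apply: Wv => //; split=> //;
      by rewrite expn0 divn1.
    rewrite distrC; apply: le_trans (fW _ _ t0 rt) _; apply: Wv => //; split=> //;
      by rewrite expn0 divn1.
  - move=> s t s0 st l; have t0 : 0 <= t by exact: le_trans st.
    split; last by apply: Wv => //; split=> //; rewrite expn0 divn1.
    have -> : f t - f (r 0%N t) - (f s - f (r 0%N s)) = f t - f s.
      by rewrite /r l; ring.
    exact: fW.
move=> m mM; apply: (@pvar_le_cells p1 p2 (fun t => lam t %/ 2 ^ m)%N _ _ (fun=> 0)) => //.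
- by move=> s t s0 st; apply: leq_div2r; exact: lam_nd.
- by move=> t t0; apply: leq_div2r; exact: lam_b.
- by move=> j; exact: chain_step_ge0.
- move=> t t0; rewrite /chain_step; case: asboolP => [_|]; last first.
    by move=> []; exists t; split.
  by rewrite /r expnSr divnMA.
- move=> s t s0 st l; rewrite subrr chain_step_ge0; split=> //.
  by rewrite /r expnSr !divnMA l subrr normr0.
Qed.

End chain.
End cells.

(** * Means of counts over independent copies *)

Section mean_bound.
Context {d : measure_display} {T : measurableType d} {R : realType}.
Variable P : probability T R.
Implicit Types (g h : T -> R) (a b c : R).

(** Measurability and positivity are bundled so that bounds on means combine
    without side conditions. *)
Definition mean_le g a := [/\ measurable_fun setT g, forall w, 0 <= g w &
  (\int[P]_w (g w)%:E <= a%:E)%E].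

Lemma mean_leW g a b : a <= b -> mean_le g a -> mean_le g b.
Proof. by move=> ab [mg g0 ga]; split=> //; apply: le_trans ga _; rewrite lee_fin. Qed.

Lemma mean_le_cst c : 0 <= c -> mean_le (fun=> c) c.
Proof.
move=> c0; split=> //; have := integral_cst P measurableT c%:E => /= ->.
by rewrite probability_setT mule1.
Qed.

Lemma mean_leD g h a b : mean_le g a -> mean_le h b ->
  mean_le (fun w => g w + h w) (a + b).
Proof.
move=> [mg g0 ga] [mh h0 hb]; split.
- exact: measurable_funD.
- by move=> w; rewrite addr_ge0.
- under eq_integral do rewrite EFinD.
  rewrite ge0_integralD//; first by rewrite EFinD leeD.
  + by move=> w _; rewrite lee_fin.
  + exact/measurable_EFinP.
  + by move=> w _; rewrite lee_fin.
  + exact/measurable_EFinP.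
Qed.

Lemma mean_leZ c g a : 0 <= c -> mean_le g a -> mean_le (fun w => c * g w) (c * a).
Proof.
move=> c0 [mg g0 ga]; split.
- exact: measurable_funM.
- by move=> w; rewrite mulr_ge0.
- under eq_integral do rewrite EFinM.
  rewrite ge0_integralZl//.
  + by rewrite EFinM lee_wpmul2l// lee_fin.
  + exact/measurable_EFinP.
  + by move=> w _; rewrite lee_fin.
Qed.

Lemma mean_le_sum (n : nat) (g : nat -> T -> R) (a : nat -> R) :
  (forall i, (i < n)%N -> mean_le (g i) (a i)) ->
  mean_le (fun w => \sum_(i < n) g i w) (\sum_(i < n) a i).
Proof.
elim: n => [|n IH] H.
  rewrite big_ord0 (_ : (fun _ => _) = fun=> 0); first exact: mean_le_cst.
  by apply/funext => w; rewrite big_ord0.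
rewrite big_ord_recr/= (_ : (fun _ => _) = fun w => \sum_(i < n) g i w + g n w).
  by apply: mean_leD; [apply: IH => i ni; apply: H; exact: ltnW | exact: H].
by apply/funext => w; rewrite big_ord_recr.
Qed.

Lemma mean_le_dom g h b : measurable_fun setT g -> (forall w, 0 <= g w <= h w) ->
  mean_le h b -> mean_le g b.
Proof.
move=> mg gh [mh h0 hb]; split=> //; first by move=> w; case/andP: (gh w).
apply: le_trans hb; apply: ge0_le_integral => //.
- by move=> w _; rewrite lee_fin; case/andP: (gh w).
- exact/measurable_EFinP.
- exact/measurable_EFinP.
- by move=> w _; rewrite lee_fin; case/andP: (gh w).
Qed.

(** The [p]-variation norm of a random path is a supremum over uncountably many
    partitions, so its measurability is left open: the comparison goes through
    the definition of the integral by the simple functions lying below. *)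
Lemma le_integral_dominated (f : T -> \bar R) g a : (forall w, 0 <= f w)%E ->
  (forall w, f w <= (g w)%:E)%E -> mean_le g a -> (\int[P]_w f w <= a%:E)%E.
Proof.
move=> f0 fg [mg g0 ga]; apply: le_trans ga.
rewrite !ge0_integralTE//.
apply: ge_ereal_sup => _ [h hf <-]; apply: ereal_sup_ubound; exists h => // w.
exact: le_trans (fg w).
Qed.

End mean_bound.

Section path_events.
Context {d : measure_display} {T : measurableType d} {R : realType}.
Variable P : probability T R.
Variable N : \bar R -> {RV P >-> R}.

(** The path map is measurable for the product sigma-algebra because its
    coordinates are. *)
Lemma measurable_path A : path_measurable A -> measurable (path_of N @^-1` A).
Proof.
pose G : set (set (\bar R -> R)) := [set A | exists (t : \bar R) (B : set R),
         [/\ (0 <= t)%E, measurable B & A = [set x | B (x t)]] ].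
have mN : @measurable_fun _ _ T (g_sigma_algebraType G) setT (path_of N).
  have gen := @measurability _ _ T (g_sigma_algebraType G) setT (path_of N) G erefl.
  apply: gen => _ [_ [t [B [t0 mB ->]]] <-]; rewrite setTI.
  exact: (@measurable_funPTI _ _ _ _ (N t) B mB).
by move=> mA; rewrite -(setTI (_ @^-1` _)); exact: mN.
Qed.

Definition path_prob (A : set (\bar R -> R)) : R := fine (P (path_of N @^-1` A)).

Lemma path_probE A : path_measurable A ->
  P (path_of N @^-1` A) = (path_prob A)%:E.
Proof.
by move=> /measurable_path mA; rewrite fineK// fin_num_measure.
Qed.

Lemma path_prob_ge0 A : 0 <= path_prob A.
Proof. by rewrite fine_ge0. Qed.

End path_events.

Section path_algebra.
Context {R : realType}.
Implicit Types A B : set (\bar R -> R).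

Lemma path_measurableT : path_measurable (setT : set (\bar R -> R)).
Proof. exact: (@measurableT _ (g_sigma_algebraType _)). Qed.

Lemma path_measurableD A B :
  path_measurable A -> path_measurable B -> path_measurable (A `\` B).
Proof. exact: (@measurableD _ (g_sigma_algebraType _)). Qed.

Lemma path_measurable_bigcup (F : nat -> set (\bar R -> R)) :
  (forall i, path_measurable (F i)) -> path_measurable (\bigcup_i F i).
Proof.
by move=> H; apply: (@bigcupT_measurable _ (g_sigma_algebraType _)) => i; exact: H.
Qed.

Lemma path_measurable_bigcap (F : nat -> set (\bar R -> R)) :
  (forall i, path_measurable (F i)) -> path_measurable (\bigcap_i F i).
Proof.
by move=> H; apply: (@bigcapT_measurable _ (g_sigma_algebraType _)) => i; exact: H.
Qed.

Lemma path_measurable_coord (t : \bar R) (B : set R) : (0 <= t)%E -> measurable B ->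
  path_measurable [set x | B (x t)].
Proof. by move=> t0 mB; apply: sub_sigma_algebra; exists t, B. Qed.

End path_algebra.

Section counts.
Context {d : measure_display} {T : measurableType d} {R : realType}.
Variable P : probability T R.
Variables (n : nat) (Ns : 'I_n -> \bar R -> {RV P >-> R}).
Hypothesis indep : independent_processes Ns.
Variables (A : set (\bar R -> R)) (q : R).
Hypothesis mA : path_measurable A.
Hypothesis qA : forall i, P (path_of (Ns i) @^-1` A) = q%:E.

Definition count_in (w : T) : nat := (\sum_(i < n) (path_of (Ns i) w \in A))%N.

Let E i := path_of (Ns i) @^-1` A.
Let mE i : measurable (E i).
Proof. exact: measurable_path. Qed.

Lemma count_inE w : (count_in w)%:R = \sum_(i < n) \1_(E i) w :> R.
Proof.
rewrite natr_sum; apply: eq_bigr => i _; congr ((_ : bool)%:R).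
Qed.

Lemma measurable_count : measurable_fun setT (fun w => (count_in w)%:R : R).
Proof.
under eq_fun do rewrite count_inE.
by apply: measurable_sum => i; exact: measurable_indic.
Qed.

Lemma integral_count : (\int[P]_w ((count_in w)%:R : R)%:E = (n%:R * q)%:E)%E.
Proof.
under eq_integral do rewrite count_inE -sumEFin.
rewrite ge0_integral_sum//=.
- rewrite (eq_bigr (fun=> q%:E)); last first.
    by move=> i _; rewrite integral_indic// setIT; exact: qA.
  by rewrite sumEFin sumr_const card_ord mulr_natl.
- by move=> i; apply/measurable_EFinP; exact: measurable_indic.
Qed.

(** The product rule over the whole family, with the full path space in all
    places but [i] and [j]. *)
Lemma pair_prob (i j : 'I_n) : i != j -> P (E i `&` E j) = (q * q)%:E.
Proof.
move=> ij.
pose F (l : 'I_n) := if (l == i) || (l == j) then A else setT.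
have mF l : path_measurable (F l).
  by rewrite /F; case: ifP => _ //; exact: path_measurableT.
have := indep mF; rewrite (_ : \bigcap_(_ in _) _ = E i `&` E j).
  move=> ->; rewrite (bigD1 i)//= (bigD1 j) 1?eq_sym//= big1 ?mule1.
    by rewrite /F !eqxx orbT /= !qA.
  move=> l /andP[li lj]; rewrite /F (negbTE li) (negbTE lj)/=.
  by rewrite preimage_setT probability_setT.
apply/seteqP; split => [w H|w [Hi Hj] l _].
  by split; [have := H i I | have := H j I]; rewrite /F eqxx ?orbT.
by rewrite /F; case: (eqVneq l i) => [->|_] //=; case: (eqVneq l j) => [->|_].
Qed.

(** The square of the count is a sum of indicators over pairs of copies: [n]
    diagonal pairs of probability [q], and off-diagonal ones of probability
    [q ^+ 2] by independence. *)
Lemma integral_count_sqr :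
  (\int[P]_w ((count_in w)%:R ^+ 2 : R)%:E
   = (n%:R * q + (n%:R * q) ^+ 2 - n%:R * q ^+ 2)%:E)%E.
Proof.
have -> : (fun w => ((count_in w)%:R ^+ 2 : R)%:E) =
   (fun w => \sum_(i < n) \sum_(j < n) (\1_(E i `&` E j) w)%:E)%E.
  apply/funext => w; rewrite count_inE expr2 mulr_suml -sumEFin.
  apply: eq_bigr => i _; rewrite mulr_sumr -sumEFin; apply: eq_bigr => j _.
  by rewrite indicI.
have mI i j : measurable (E i `&` E j) by exact: measurableI.
rewrite ge0_integral_sum//=; last 2 first.
- move=> i; apply: emeasurable_sum => j; apply/measurable_EFinP.
  exact: measurable_indic.
- by move=> i w _; apply: sume_ge0 => j _; rewrite lee_fin.
have H i : (\int[P]_w (\sum_(j < n) (\1_(E i `&` E j) w)%:E) =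
            (q + n%:R * q ^+ 2 - q ^+ 2)%:E)%E.
  rewrite ge0_integral_sum//=; last first.
    by move=> j; apply/measurable_EFinP; exact: measurable_indic.
  rewrite (eq_bigr (fun j => (if j == i then q else q * q)%:E)); last first.
    move=> j _; rewrite integral_indic// setIT; case: eqVneq => [->|ji].
      by rewrite setIid; exact: qA.
    by apply: pair_prob; rewrite eq_sym.
  rewrite sumEFin (bigD1 i)//= eqxx (eq_bigr (fun=> q * q)); last first.
    by move=> j /negbTE ->.
  rewrite sumr_const; congr EFin.
  rewrite cardC1 card_ord -[_ *+ n.-1]mulr_natl.
  have -> : n.-1%:R = n%:R - 1 :> R.
    by case: n i => [[]//|n' _]; rewrite -natr1 addrK.
  ring.
under eq_bigr => i _ do rewrite H.
by rewrite sumEFin sumr_const card_ord -[_ *+ n in LHS]mulr_natl; congr EFin; ring.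
Qed.

Lemma mean_count_sqr :
  mean_le P (fun w => (count_in w)%:R ^+ 2) (n%:R * q + (n%:R * q) ^+ 2).
Proof.
split; [|by move=> w; exact: sqr_ge0|].
- exact: measurable_funX measurable_count.
- by rewrite integral_count_sqr lee_fin gerBl mulr_ge0// sqr_ge0.
Qed.

(** The variance of a binomial variable, bounded by its mean. *)
Lemma mean_count_var : 0 <= q ->
  mean_le P (fun w => ((count_in w)%:R - n%:R * q) ^+ 2) (n%:R * q).
Proof.
move=> qge0; have c0 : 0 <= n%:R * q by rewrite mulr_ge0.
have mc := measurable_count.
have mv : measurable_fun setT (fun w => ((count_in w)%:R - n%:R * q : R) ^+ 2).
  by apply: measurable_funX; exact: measurable_funB.
have m1 : measurable_fun setT (fun w => (2 * (n%:R * q)) * (count_in w)%:R : R).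
  exact: measurable_funM.
have m2 : measurable_fun setT (fun w => (count_in w)%:R ^+ 2 : R).
  exact: measurable_funX.
split=> //; first by move=> w; exact: sqr_ge0.
(* The expansion of the square is written with nonnegative terms on both
   sides, so that the integral is additive. *)
have e : (\int[P]_w ((((count_in w)%:R - n%:R * q) ^+ 2)%:E +
            ((2 * (n%:R * q)) * (count_in w)%:R)%:E) =
          \int[P]_w (((count_in w)%:R ^+ 2)%:E + ((n%:R * q) ^+ 2)%:E))%E.
  by apply: eq_integral => w _; rewrite -!EFinD; congr EFin; ring.
rewrite !ge0_integralD// in e; try (exact/measurable_EFinP);
  try by move=> w _; rewrite lee_fin ?sqr_ge0// !mulr_ge0.
have ic := integral_cst P measurableT ((n%:R * q) ^+ 2)%:E; rewrite /= in ic.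
rewrite integral_count_sqr ic probability_setT mule1 in e.
have i1 : (\int[P]_w ((2 * (n%:R * q)) * (count_in w)%:R)%:E =
           (2 * (n%:R * q) * (n%:R * q))%:E)%E.
  under eq_integral do rewrite EFinM.
  rewrite ge0_integralZl//; try (exact/measurable_EFinP);
    try by rewrite lee_fin mulr_ge0.
  by rewrite integral_count.
rewrite i1 -!EFinD in e.
move: e; set X := (\int[P]_w _)%E => e.
have Xf : X \is a fin_num.
  by move: e; case: X.
rewrite -(fineK Xf) -EFinD in e *; case: e => e; rewrite lee_fin.
have : 0 <= n%:R * q ^+ 2 by rewrite mulr_ge0// sqr_ge0.
by move: e; set c := n%:R * q; lra.
Qed.

End counts.

(** * Level sets of counting paths *)

Section cofinal.
Context {R : realType}.
Implicit Types D : set R.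

(** Either [D] has a maximum, which is then the first term, or between any point
    and some larger point of [D] there is a rational, and choosing a point of [D]
    above each rational exhausts [D]. Running maxima make the sequence monotone. *)
Lemma cofinal_seq D : D !=set0 -> exists u : nat -> R,
  [/\ forall m, D (u m), {homo u : m n / (m <= n)%N >-> m <= n} &
      forall x, D x -> exists m, x <= u m].
Proof.
move=> [y0 Dy0].
pose top : R := xget y0 [set y | D y /\ ubound D y].
pose r i : R := ratr (odflt 0 (unpickle i)).
pose v i : R := xget y0 [set y | D y /\ r i <= y].
have Dtop : D top by rewrite /top; case: xgetP => [y _ [//]|_]; exact: Dy0.
have Dv i : D (v i) by rewrite /v; case: xgetP => [y _ [//]|_]; exact: Dy0.
pose u := fix u m := if m is m'.+1 then Order.max (u m') (v m') else top.
have Du m : D (u m).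
  by elim: m => //= m IH; rewrite /Order.max; case: ifP.
have u_nd : {homo u : m n / (m <= n)%N >-> m <= n}.
  apply: homo_leq => //; first exact: le_trans.
  by move=> m /=; rewrite le_max lexx.
exists u; split=> // x Dx.
have [xub|] := pselect (ubound D x).
  exists 0%N; rewrite /= /top.
  have : [set y | D y /\ ubound D y] top by apply: (@xgetPex _ y0); exists x.
  by case=> _; apply.
move=> /existsNP[y /not_implyP[Dy /negP]]; rewrite -ltNge => /rat_in_itvoo[q].
rewrite in_itv/= => /andP[xq qy].
exists (pickle q).+1; rewrite /= le_max; apply/orP; right.
have [_] : [set y | D y /\ r (pickle q) <= y] (v (pickle q)).
  apply: (@xgetPex _ y0); exists y; split=> //.
  by rewrite /r pickleK/= ltW.
by apply: le_trans; rewrite /r pickleK/= ltW.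
Qed.

Lemma coinitial_seq D : D !=set0 -> exists u : nat -> R,
  [/\ forall m, D (u m), {homo u : m n / (m <= n)%N >-> n <= m} &
      forall x, D x -> exists m, u m <= x].
Proof.
move=> [y Dy]; have [|u [Du u_nd cof]] := @cofinal_seq [set x | D (- x)].
  by exists (- y); rewrite /= opprK.
exists (fun m => - u m); split=> //.
- by move=> m n mn; rewrite lerN2 u_nd.
- move=> x Dx; have [|m xu] := cof (- x); first by rewrite /= opprK.
  by exists m; rewrite lerNl.
Qed.

End cofinal.

Section levels.
Context {R : realType}.

(** Indexed from [k.+1], as a counting path is always above 0; the indicators of
    the levels then add up to the path. *)
Definition level (k : nat) (t : R) : set (\bar R -> R) :=
  [set x | k.+1%:R <= x t%:E].

Lemma level_measurable k t : 0 <= t -> path_measurable (level k t).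
Proof.
move=> t0; rewrite /level.
have -> : [set x : \bar R -> R | k.+1%:R <= x t%:E] =
          [set x | [set` `[(k.+1%:R : R), +oo[ ] (x t%:E)].
  by apply/seteqP; split=> x /=; rewrite in_itv/= andbT.
by apply: path_measurable_coord; [rewrite lee_fin | exact: measurable_itv].
Qed.

Context {d : measure_display} {T : measurableType d}.
Variable P : probability T R.
Variable N : \bar R -> {RV P >-> R}.
Hypothesis cN : counting_process N.

Lemma level_le k s t w : 0 <= s -> s <= t ->
  level k s (path_of N w) -> level k t (path_of N w).
Proof.
move=> s0 st /le_trans; apply; apply: (counting_nondecreasing cN).
  by rewrite lee_fin.
by rewrite lee_fin.
Qed.

Variable k : nat.
Local Notation G t := (path_prob N (level k t)).

Lemma level_probD s t : 0 <= s -> s <= t ->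
  path_prob N (level k t `\` level k s) = G t - G s.
Proof.
move=> s0 st; have t0 : 0 <= t by exact: le_trans st.
have ms := level_measurable k s0; have mt := level_measurable k t0.
have mps := measurable_path N ms; have mpt := measurable_path N mt.
rewrite /path_prob [X in P X](_ : _ =
  path_of N @^-1` level k t `\` path_of N @^-1` level k s)// measureD//; last first.
  by rewrite ltey_eq fin_num_measure.
rewrite fineB ?fin_num_measure//; last exact: measurableI.
rewrite setIidr//.
by move=> w; exact: level_le.
Qed.

Lemma level_prob_le s t : 0 <= s -> s <= t -> G s <= G t.
Proof. by move=> s0 st; rewrite -subr_ge0 -level_probD// path_prob_ge0. Qed.

(** The event that a path crosses level [k.+1] between two times of [D] is an
    uncountable union. On counting paths it is captured by a cofinal and a
    coinitial sequence of [D], and continuity from below passes the bound [rho]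
    from pairs of times to the union. For a cell, this is the event that the jump
    falls after its start; [rho] does not see an atom at its right end, because
    an atom too large for the cell belongs to a later one. *)
Lemma cell_event (D : set R) (rho : R) : 0 <= rho ->
  (forall t, D t -> 0 <= t) ->
  (forall s t, D s -> D t -> s <= t -> G t - G s <= rho) ->
  exists E, [/\ path_measurable E, path_prob N E <= rho &
    forall d' (T' : measurableType d') (P' : probability T' R)
      (N' : \bar R -> {RV P' >-> R}), counting_process N' ->
      forall w s t, D s -> D t ->
      (level k t `\` level k s) (path_of N' w) -> E (path_of N' w)].
Proof.
move=> rho0 D0 DG; have [Dne|D_0] := pselect (D !=set0); last first.
  exists set0; split.
  - by rewrite -(setDv setT); apply: path_measurableD; exact: path_measurableT.
  - by rewrite /path_prob preimage_set0 measure0.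
  - by move=> ? ? ? ? _ w s t Ds; case: D_0; exists s.
have [u [Du u_nd u_cof]] := cofinal_seq Dne.
have [v [Dv v_ni v_coi]] := coinitial_seq Dne.
have u0 m := D0 _ (Du m); have v0 m := D0 _ (Dv m).
pose E := (\bigcup_m level k (u m)) `\` (\bigcap_m level k (v m)).
have mE : path_measurable E.
  apply: path_measurableD.
    by apply: path_measurable_bigcup => m; exact: level_measurable.
  by apply: path_measurable_bigcap => m; exact: level_measurable.
exists E; split=> //.
  rewrite -lee_fin -path_probE//.
  pose F m := path_of N @^-1` (level k (u m) `\` level k (v m)).
  have mF' m : path_measurable (level k (u m) `\` level k (v m)).
    by apply: path_measurableD; exact: level_measurable.
  have mF m : measurable (F m) by exact: measurable_path.
  have F_nd : nondecreasing_seq F.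
    move=> m1 m2 m12; apply/subsetPset => w [H1 H2]; split.
      by apply: level_le H1 => //; exact: u_nd.
    by move=> H; apply: H2; apply: level_le H => //; exact: v_ni.
  have -> : path_of N @^-1` E = \bigcup_m F m.
    apply/seteqP; split => [w [[a _ Ha] Hb]|w [m _ [Ha Hb]]].
      have /existsNP[b /not_implyP[_ Hb']] := Hb.
      exists (maxn a b) => //; split.
        by apply: level_le Ha => //; apply: u_nd; exact: leq_maxl.
      by move=> H; apply: Hb'; apply: level_le H => //; apply: v_ni; exact: leq_maxr.
    by split; [exists m | move=> H; apply: Hb; exact: H].
  have := @nondecreasing_cvg_mu _ _ _ P F mF (bigcupT_measurable _ mF) F_nd.
  move/cvge_to_le; apply; apply: nearW => m.
  rewrite [leLHS](path_probE N (mF' m)) lee_fin.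
  have [vu|/ltW uv] := leP (v m) (u m); first by rewrite level_probD// DG.
  rewrite /path_prob (_ : _ @^-1` _ = set0) ?measure0//.
  by rewrite -subset0 => w [H1]; apply; apply: level_le H1.
move=> d' T' P' N' cN' w s t Ds Dt [Ht Hs].
have [a ta] := u_cof _ Dt; have [b bs] := v_coi _ Ds.
have lev' x y : 0 <= x -> x <= y -> level k x (path_of N' w) ->
    level k y (path_of N' w).
  move=> x0 xy /le_trans; apply; apply: (counting_nondecreasing cN');
  by rewrite lee_fin.
split; first by exists a => //; apply: lev' Ht => //; exact: D0.
by move=> /(_ b I) H; apply: Hs; apply: lev' H.
Qed.

End levels.

(** * One-jump processes *)

Section powers_of_mean.
Context {d : measure_display} {T : measurableType d} {R : realType}.
Variable P : probability T R.
Variable p : R.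
Implicit Types (g : T -> R).

Lemma mean_le_powR g s : 1 <= p -> p <= 2 -> 0 < s -> measurable_fun setT g ->
  (forall w, 0 <= g w) -> mean_le P (fun w => g w ^+ 2) (s ^+ 2) ->
  mean_le P (fun w => g w `^ p) (2 * s `^ p).
Proof.
move=> p1 p2 s0 mg g0 g2.
have h : mean_le P (fun w => s `^ p * (1 + (s ^+ 2)^-1 * g w ^+ 2))
                   (s `^ p * (1 + (s ^+ 2)^-1 * s ^+ 2)).
  apply: mean_leZ; first exact: powR_ge0.
  by apply: mean_leD; [exact: mean_le_cst | apply: mean_leZ => //; rewrite invr_ge0 sqr_ge0].
apply: mean_le_dom (mean_leW _ h).
- exact: (measurableT_comp (measurable_powR p)).
- move=> w; rewrite powR_ge0/= [_^-1 * _]mulrC; exact: powR_le_linear.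
- by rewrite mulVf ?expf_eq0 ?gt_eqF// mulrC.
Qed.

(** For an integer, the [p]-th power is at most the square; for a number in the unit
    interval, it is at most the number itself. *)
Lemma mean_le_nat_powR (X : T -> nat) a c : 1 <= p -> p <= 2 -> 0 <= c -> c <= 1 ->
  measurable_fun setT (fun w => (X w)%:R : R) ->
  mean_le P (fun w => (X w)%:R ^+ 2) a ->
  mean_le P (fun w => ((X w)%:R + c) `^ p) (4 * (a + c)).
Proof.
move=> p1 p2 c0 c1 mX X2.
have h : mean_le P (fun w => 4 * ((X w)%:R ^+ 2 + c)) (4 * (a + c)).
  by apply: mean_leZ => //; apply: mean_leD => //; exact: mean_le_cst.
apply: mean_le_dom h.
- by apply: (measurableT_comp (measurable_powR p)); exact: measurable_funD.
- move=> w; rewrite powR_ge0/=; apply: le_trans (powR_add_le p1 p2 _ c0) _ => //.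
  rewrite ler_wpM2l// lerD//.
    case: (X w) => [|x]; first by rewrite powR0 ?sqr_ge0// gt_eqF//; lra.
    by rewrite -powR_mulrn//; apply: ler_powR => //; rewrite ler1n.
  have [->|cn0] := eqVneq c 0; first by rewrite powR0// gt_eqF//; lra.
  by rewrite ge1r_powR// c1 andbT lt0r cn0.
Qed.

End powers_of_mean.

Section jump.
Context {R : realType} (p : R).
Context {d0 : measure_display} {T0 : measurableType d0} (P0 : probability T0 R)
  (N : \bar R -> {RV P0 >-> R}).
Context {d : measure_display} {T : measurableType d} (P : probability T R).
Context (n : nat) (Ns : 'I_n -> \bar R -> {RV P >-> R}) (k : nat).
Hypotheses (cN : counting_process N) (cNs : forall i, counting_process (Ns i)).
Hypothesis sd : forall i, same_distribution (Ns i) N.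
Hypothesis indep : independent_processes Ns.

Local Notation G t := (path_prob N (level k t)).

(** The centred count of the one-jump processes obtained from the copies at level
    [k.+1]: [n] times an empirical process. *)
Definition dev (t : R) (w : T) : R := (count_in Ns (level k t) w)%:R - n%:R * G t.

Let sdE A : path_measurable A -> forall i,
  P (path_of (Ns i) @^-1` A) = (path_prob N A)%:E.
Proof. by move=> mA i; rewrite -path_probE// (sd i). Qed.

Lemma count_level s t w : 0 <= s -> s <= t ->
  count_in Ns (level k t) w =
  (count_in Ns (level k s) w + count_in Ns (level k t `\` level k s) w)%N.
Proof.
move=> s0 st; rewrite /count_in -big_split/=; apply: eq_bigr => i _.
have H := @level_le _ _ _ _ _ (cNs i) k s t w s0 st.
have [h1|h1] := boolP (path_of (Ns i) w \in level k s).
  have h2 : path_of (Ns i) w \in level k t.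
    by apply/mem_set/H; rewrite inE in h1.
  have h3 : path_of (Ns i) w \in level k t `\` level k s = false.
    by apply/negbTE/negP; rewrite inE => -[_]; apply; rewrite inE in h1.
  by rewrite h2 h3.
rewrite add0n; congr nat_of_bool; rewrite notin_setE in h1.
by apply/idP/idP => /set_mem h; apply/mem_set; [split | case: h].
Qed.

Lemma count_sub (A B : set (\bar R -> R)) w :
  (forall i, A (path_of (Ns i) w) -> B (path_of (Ns i) w)) ->
  (count_in Ns A w <= count_in Ns B w)%N.
Proof.
move=> AB; rewrite /count_in; apply: leq_sum => i _.
have [/set_mem/AB/mem_set -> //|//] := boolP (path_of (Ns i) w \in A).
Qed.

Lemma devB s t w : 0 <= s -> s <= t -> dev t w - dev s w =
  (count_in Ns (level k t `\` level k s) w)%:R -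
  n%:R * path_prob N (level k t `\` level k s).
Proof.
by move=> s0 st; rewrite /dev (count_level w s0 st) (level_probD cN k s0 st) natrD; ring.
Qed.

(** Increments of [dev] are centred binomial variables. *)
Lemma mean_dev_sqr s t : 0 <= s -> 0 <= t ->
  mean_le P (fun w => (dev t w - dev s w) ^+ 2) `|n%:R * G t - n%:R * G s|.
Proof.
wlog st : s t / s <= t.
  move=> H s0 t0; have [st|/ltW ts] := leP s t; first exact: H.
  rewrite distrC; have := H _ _ ts t0 s0.
  by under [X in _ -> mean_le _ X _]eq_fun do rewrite -sqrrN opprB.
move=> s0 t0; under eq_fun do rewrite (devB _ s0 st).
have mD : path_measurable (level k t `\` level k s).
  by apply: path_measurableD; exact: level_measurable.
apply: mean_leW (mean_count_var indep mD (sdE mD) (path_prob_ge0 _ _)).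
rewrite ger0_norm -mulrBr; first by rewrite level_probD.
by rewrite mulr_ge0// subr_ge0 level_prob_le.
Qed.

Lemma measurable_dev t : 0 <= t -> measurable_fun setT (dev t).
Proof.
move=> t0; apply: measurable_funB => //.
by apply: measurable_count; exact: level_measurable.
Qed.

Section chaining.
Hypotheses (p1 : 1 <= p) (p2 : p < 2).
Hypothesis n0 : (0 < n)%N.
Variable qb : R.
Hypotheses (qb0 : 0 < qb) (Gq : forall t : R, 0 <= t -> G t <= qb).

Let n0R : 0 < n%:R :> R. Proof. by rewrite ltr0n. Qed.

(* [nu] bounds the expected number of jumps in the whole sample, and [lam]
   cuts time into cells that expect about one jump each. *)
Let nu : R := n%:R * qb.
Let nu0 : 0 < nu. Proof. exact: mulr_gt0. Qed.

Let lam (t : R) : nat := Num.truncn (n%:R * G t).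
Let b : nat := Num.truncn nu.

Let nG0 t : 0 <= n%:R * G t. Proof. by rewrite mulr_ge0// path_prob_ge0. Qed.

Let nGq (t : R) : 0 <= t -> n%:R * G t <= nu.
Proof. by move=> t0; rewrite ler_wpM2l// Gq. Qed.

Let nGle (s t : R) : 0 <= s -> s <= t -> n%:R * G s <= n%:R * G t.
Proof. by move=> s0 st; rewrite ler_wpM2l// (level_prob_le cN k s0 st). Qed.

Let lam_nd (s t : R) : 0 <= s -> s <= t -> (lam s <= lam t)%N.
Proof. by move=> s0 st; apply: le_truncn; exact: nGle. Qed.

Let lam_b (t : R) : 0 <= t -> (lam t <= b)%N.
Proof. by move=> t0; apply: le_truncn; exact: nGq. Qed.

Let cell_close m j (s t : R) : cell lam m j s -> cell lam m j t ->
  `|n%:R * G t - n%:R * G s| <= 2 ^+ m.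
Proof.
have sub x y : cell lam m j x -> cell lam m j y ->
    n%:R * G y - n%:R * G x <= 2 ^+ m.
  move=> [x0 xj] [y0 yj].
  have h1 : n%:R * G y < ((j.+1 * 2 ^ m)%N)%:R.
    rewrite -truncn_lt_nat// mulSn -[X in (X < _)%N]/(lam y).
    by rewrite {1}(divn_eq (lam y) (2 ^ m)) yj addnC ltn_add2r ltn_mod expn_gt0.
  have h2 : ((j * 2 ^ m)%N)%:R <= n%:R * G x.
    rewrite -truncn_ge_nat// -[X in (_ <= X)%N]/(lam x) -xj; exact: leq_trunc_div.
  have : ((j.+1 * 2 ^ m)%N)%:R = ((j * 2 ^ m)%N)%:R + 2 ^+ m :> R.
    by rewrite mulSn natrD addrC natrX.
  lra.
move=> cs ct; rewrite ler_norml (sub _ _ cs ct) andbT.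
by have := sub _ _ ct cs; lra.
Qed.

(* The ratio of the geometric series of the links; it is below 1 because
   [p < 2]. *)
Let theta : R := 2 `^ (2^-1 - p^-1).

Let step m j (w : T) := chain_step lam (dev ^~ w) m j.

(* A link at depth [m] stays in a cell of depth [m.+1], where at most
   [2 ^+ m.+1] jumps are expected: this is the square of its typical size. *)
Let scale m : R := 2 `^ (m.+1%:R / 2).

Let scale0 m : 0 < scale m. Proof. exact: powR_gt0. Qed.

Let scale_sqr m : scale m ^+ 2 = 2 ^+ m.+1.
Proof.
rewrite -powR_mulrn ?powR_ge0// /scale -powRrM divfK ?pnatr_eq0//.
by rewrite powR_mulrn.
Qed.

Let mean_step m j : mean_le P (fun w => step m j w `^ p) (2 * scale m `^ p).
Proof.
apply: mean_le_powR => //; first exact: ltW.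
- rewrite /step /chain_step; case: asboolP => [ne|_]; last exact: measurable_cst.
  have [x0 _] := rep_in_cell ne; have [y0 _] := cell_parent (rep_in_cell ne).
  have [z0 _] : cell lam m.+1 (j %/ 2) (rep lam m.+1 (j %/ 2)).
    apply: rep_in_cell; exists (rep lam m j); exact: (cell_parent (rep_in_cell ne)).
  by apply: measurableT_comp => //; apply: measurable_funB; exact: measurable_dev.
- by move=> w; exact: chain_step_ge0.
- rewrite scale_sqr /step /chain_step; case: asboolP => [ne|_]; last first.
    apply: mean_leW (mean_le_cst _ _); last by rewrite expr0n.
    by rewrite expr0n exprn_ge0.
  have cx := cell_parent (rep_in_cell ne).
  have cy : cell lam m.+1 (j %/ 2) (rep lam m.+1 (j %/ 2)).
    by apply: rep_in_cell; exists (rep lam m j).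
  under eq_fun do rewrite real_normK ?num_real//.
  apply: mean_leW (cell_close cy cx) _.
  by apply: mean_dev_sqr; [case: cy | case: cx].
Qed.

Let ncell m : R := (b %/ 2 ^ m).+1%:R.

Let ncell0 m : 0 < ncell m. Proof. by rewrite ltr0n. Qed.

Let link_bound m (w : T) : R := (ncell m * scale m `^ p) `^ p^-1 *
  (1 + 9 * (\sum_(0 <= j < (b %/ 2 ^ m).+1) step m j w `^ p) / (ncell m * scale m `^ p)).

Let p0 : 0 < p. Proof. exact: lt_le_trans p1. Qed.

(* There are about [nu / 2 ^+ m] cells at depth [m], each with a link of size
   [2 `^ (m.+1 / 2)]. The [p]-th root of the sum of the [p]-th powers decays
   like [theta ^+ m]. *)
Let mean_link_bound m : (2 ^ m <= b)%N -> mean_le P (link_bound m) (76 * nu `^ p^-1 * theta ^+ m).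
Proof.
move=> mb.
have a0 : 0 < ncell m * scale m `^ p by rewrite mulr_gt0// powR_gt0.
have h : mean_le P (link_bound m) ((ncell m * scale m `^ p) `^ p^-1 *
    (1 + (9 / (ncell m * scale m `^ p)) * (\sum_(j < (b %/ 2 ^ m).+1) 2 * scale m `^ p))).
  rewrite /link_bound; apply: mean_leZ; first exact: powR_ge0.
  apply: mean_leD; first exact: mean_le_cst.
  under eq_fun do rewrite mulrAC big_mkord.
  apply: mean_leZ; first by rewrite divr_ge0// ltW.
  apply: (mean_le_sum (g := fun j w => step m j w `^ p)
    (a := fun=> 2 * scale m `^ p)) => j _.
  exact: mean_step.
apply: mean_leW h.
rewrite sumr_const card_ord -[_ *+ (b %/ 2 ^ m).+1]mulr_natl -/(ncell m).
have -> : 9 / (ncell m * scale m `^ p) * (ncell m * (2 * scale m `^ p)) = 18.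
  by field; rewrite !gt_eqF// powR_gt0.
rewrite powRM ?powR_ge0 ?(ltW (ncell0 m))// -powRrM mulfV ?gt_eqF//.
rewrite powRr1 ?(ltW (scale0 m))//.
have hJ : ncell m <= 2 * nu / 2 ^+ m.
  have e2 : 0 < 2 ^+ m :> R by rewrite exprn_gt0.
  rewrite ler_pdivlMr// /ncell -natrX -natrM.
  apply: (@le_trans _ _ (2 * b%:R)).
    rewrite -natrM ler_nat mulSn mul2n -addnn leq_add//; exact: leq_trunc_div.
  by rewrite ler_wpM2l// truncn_le ltW.
have hJp : ncell m `^ p^-1 <= (2 * nu / 2 ^+ m) `^ p^-1.
  rewrite ge0_ler_powR ?nnegrE ?invr_ge0 ?(ltW p0)// ?(ltW (ncell0 m))//.
  by rewrite divr_ge0// ?mulr_ge0 ?exprn_ge0// ltW.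
apply: (@le_trans _ _ ((2 * nu / 2 ^+ m) `^ p^-1 * scale m * (1 + 18))).
  by rewrite ler_wpM2r// ler_wpM2r// ltW.
have e1 : (2 * nu / 2 ^+ m) `^ p^-1 = 2 `^ p^-1 * nu `^ p^-1 * 2 `^ (- (m%:R * p^-1)).
  have h1 : 0 <= 2 * nu by rewrite mulr_ge0// ltW.
  have h2 : 0 <= (2 ^+ m)^-1 :> R by rewrite invr_ge0 exprn_ge0.
  rewrite (powRM _ h1 h2) (powRM _ _ (ltW nu0))//; congr (_ * _).
  by rewrite -powR_mulrn// -powRN -powRrM mulNr.
have e2 : scale m = 2 `^ 2^-1 * 2 `^ (m%:R * 2^-1).
  rewrite -powRD ?pnatr_eq0 ?implybT//; congr (_ `^ _).
  by rewrite -natr1 mulrDl mul1r addrC.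
have e3 : 2 `^ (- (m%:R * p^-1)) * 2 `^ (m%:R * 2^-1) = theta ^+ m.
  rewrite -powRD ?pnatr_eq0 ?implybT// -powR_mulrn ?powR_ge0// -powRrM.
  by congr (_ `^ _); ring.
have c1 : 2 `^ p^-1 <= 2 :> R by apply: ler1_powR; rewrite ?invf_le1// ler1n.
have c2 : 2 `^ 2^-1 <= 2 :> R by apply: ler1_powR; rewrite ?invf_le1// ler1n.
rewrite e1 e2.
have -> : 2 `^ p^-1 * nu `^ p^-1 * 2 `^ (- (m%:R * p^-1)) *
   (2 `^ 2^-1 * 2 `^ (m%:R * 2^-1)) * (1 + 18) =
   19 * (2 `^ p^-1 * 2 `^ 2^-1) * nu `^ p^-1 * theta ^+ m.
  by rewrite -e3; ring.
rewrite ler_wpM2r ?exprn_ge0 ?powR_ge0// ler_wpM2r ?powR_ge0//.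
have : 2 `^ p^-1 * 2 `^ 2^-1 <= 2 * 2 :> R by rewrite ler_pM ?powR_ge0.
lra.
Qed.

Let theta_lt1 : theta < 1.
Proof.
rewrite /theta /powR pnatr_eq0/= expR_lt1 pmulr_llt0 ?ln_gt0 ?ltr1n//.
by rewrite subr_lt0 ltf_pV2 ?posrE// ltr0n.
Qed.

(* Bounds the expected number of jumps inside a finest cell; the minimum with
   [nu] matters when less than one jump is expected overall. *)
Let beta : R := Order.min 1 nu.

Let beta0 : 0 < beta. Proof. by rewrite lt_min ltr01 nu0. Qed.
Let beta1 : beta <= 1. Proof. by rewrite ge_min lexx. Qed.

Let beta_cells : b.+1%:R * beta <= 2 * nu.
Proof.
have [nu1|nu1] := leP 1 nu.
  have bn : b%:R <= nu by rewrite truncn_le ltW.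
  rewrite -natr1 /beta min_l//; lra.
have -> : b = 0%N by apply/eqP; rewrite -leqn0 truncn_le_nat.
by rewrite /beta min_r ?(ltW nu1)//; have := nu0; lra.
Qed.

Let cell_rho j (s t : R) : cell lam 0 j s -> cell lam 0 j t -> s <= t ->
  n%:R * G t - n%:R * G s <= beta.
Proof.
move=> cs ct st; rewrite le_min; apply/andP; split.
  by have := cell_close ct cs; rewrite expr0 distrC; apply: le_trans; exact: ler_norm.
have := nGq (proj1 ct); have := nG0 s; lra.
Qed.

(** The case of a process with at most one jump, of probability at most [qb]. The
    means of the links form a geometric series, and below the finest cells the
    deviation varies by no more than the number of jumps in the cell plus their
    expected number, which has a bounded second moment. Both parts are of order
    [(n%:R * qb) `^ p^-1]. *)
Lemma jump_bound : exists A : T -> R,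
  (forall w, pvar_le p (dev ^~ w) (A w)) /\
  mean_le P A ((218 + 76 / (1 - 2 `^ (2^-1 - p^-1))) * (n%:R * qb) `^ p^-1).
Proof.
have p2' := ltW p2.
pose is_event j E := [/\ path_measurable E, path_prob N E <= beta / n%:R &
  forall i w s t, cell lam 0 j s -> cell lam 0 j t ->
    (level k t `\` level k s) (path_of (Ns i) w) -> E (path_of (Ns i) w)].
have /choice[E HE] : forall j, exists E, is_event j E.
  move=> j; have [||s t cs ct st|E [mE Eb HE]] :=
    @cell_event _ _ _ _ _ cN k (cell lam 0 j) (beta / n%:R).
  - by rewrite divr_ge0 ?ltW.
  - by move=> t [].
  - by rewrite ler_pdivlMr// mulrC mulrBr; exact: cell_rho cs ct st.
  - exists E; split=> // i; exact: HE.
pose v w j : R := (count_in Ns (E j) w)%:R + beta.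
pose M := up_log 2 b.+1.
pose a m : R := ncell m * scale m `^ p.
have a0 m : 0 < a m by rewrite mulr_gt0// powR_gt0.
have v0 w j : 0 <= v w j by rewrite addr_ge0// ltW.
pose B (w : T) : R :=
  nu `^ p^-1 * (1 + 9 * (\sum_(0 <= j < b.+1) v w j `^ p) / nu) + nu `^ p^-1.
exists (fun w => \sum_(m < M) link_bound m w + B w); split.
  move=> w.
  pose W t : R := (count_in Ns (level k t) w)%:R + n%:R * G t.
  have cle (s t : R) : 0 <= s -> s <= t ->
      (count_in Ns (level k s) w)%:R <= (count_in Ns (level k t) w)%:R :> R.
    by move=> s0 st; rewrite ler_nat (count_level w s0 st) leq_addr.
  apply: (@pvar_le_chain _ p lam b lam_nd lam_b p1 p2' (dev ^~ w) W (v w) M nu a) => //.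
  - exact: up_logP.
  - move=> s t s0 st; have h1 := cle _ _ s0 st; have h2 := nGle s0 st.
    by rewrite /dev /W ler_norml; apply/andP; split; lra.
  - move=> s t j cs ct st.
    have h := cell_rho cs ct st.
    have h2 : (count_in Ns (level k t) w)%:R - (count_in Ns (level k s) w)%:R
              <= (count_in Ns (E j) w)%:R :> R.
      rewrite (count_level w (proj1 cs) st) natrD addrAC subrr add0r ler_nat.
      apply: count_sub => i; have [_ _ Ei] := HE j; exact: Ei.
    rewrite /W /v; lra.
have mv j : mean_le P (fun w => v w j `^ p) (12 * beta).
  have [mE Eb _] := HE j.
  have nE : n%:R * path_prob N (E j) <= beta.
    by rewrite mulrC -ler_pdivlMr.
  have nE0 : 0 <= n%:R * path_prob N (E j) by rewrite mulr_ge0// path_prob_ge0.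
  have mc := mean_count_sqr indep mE (sdE mE).
  have := mean_le_nat_powR p1 p2' (ltW beta0) beta1 (measurable_count _ mE) mc.
  apply: mean_leW.
  have : (n%:R * path_prob N (E j)) ^+ 2 <= beta.
    by rewrite (le_trans _ nE)// expr2 ler_piMl// (le_trans nE).
  lra.
have mB : mean_le P B (218 * nu `^ p^-1).
  have h : mean_le P B (nu `^ p^-1 * (1 + 9 / nu * (\sum_(j < b.+1) 12 * beta))
                        + nu `^ p^-1).
    rewrite /B; apply: mean_leD; last by apply: mean_le_cst; exact: powR_ge0.
    apply: mean_leZ; first exact: powR_ge0.
    apply: mean_leD; first exact: mean_le_cst.
    under eq_fun do rewrite mulrAC big_mkord.
    apply: mean_leZ; first by rewrite divr_ge0// ltW.
    exact: (mean_le_sum (g := fun j w => v w j `^ p) (a := fun=> 12 * beta)).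
  apply: mean_leW h.
  rewrite sumr_const card_ord -[_ *+ b.+1]mulr_natl.
  have -> : 218 * nu `^ p^-1 = nu `^ p^-1 * (1 + 216) + nu `^ p^-1 by ring.
  rewrite lerD2r ler_wpM2l ?powR_ge0// lerD2l mulrAC ler_pdivrMr//.
  have := beta_cells; lra.
have mA : mean_le P (fun w => \sum_(m < M) link_bound m w)
    (\sum_(m < M) 76 * nu `^ p^-1 * theta ^+ m).
  apply: (mean_le_sum (g := link_bound) (a := fun m => 76 * nu `^ p^-1 * theta ^+ m)).
  move=> m mM; apply: mean_link_bound; rewrite leqNgt; apply/negP => bm.
  by move: mM; rewrite ltnNge up_log_min.
apply: mean_leW (mean_leD mA mB).
rewrite -mulr_sumr -/theta -/nu.
have t1 : 0 < 1 - theta by rewrite subr_gt0.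
have geo := geometric_sum_le M (powR_ge0 2 _) theta_lt1.
have : 76 * nu `^ p^-1 * \sum_(m < M) theta ^+ m <= 76 * nu `^ p^-1 * (1 - theta)^-1.
  by rewrite ler_wpM2l// mulr_ge0// powR_ge0.
lra.
Qed.

End chaining.
End jump.

(** * Truncation and moments *)

Section excess.
Context {R : realType}.
Implicit Types (x y r : R) (K a : nat).

(** On natural numbers this is [x - min x K]; in this form it is what the first
    [K] levels leave of a counting process. *)
Definition excess K x : R := x - \sum_(k < K) (k.+1%:R <= x)%R%:R.

Lemma excess_nat K a : excess K a%:R = (a - K)%:R.
Proof.
rewrite /excess; have -> : \sum_(k < K) (k.+1%:R <= a%:R :> R)%R%:R = (minn a K)%:R :> R.
  elim: K => [|K IH]; first by rewrite big_ord0 minn0.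
  rewrite big_ord_recr/= IH ler_nat -natrD; congr (_%:R).
  by case: ltnP => /= h; lia.
rewrite minnE -natrB; first by congr (_%:R); lia.
by lia.
Qed.

Lemma excess_ge0 K x : x \is a Num.nat -> 0 <= excess K x.
Proof. by move=> /natrP[a ->]; rewrite excess_nat. Qed.

Lemma excess_nd K x y : x \is a Num.nat -> y \is a Num.nat -> x <= y ->
  excess K x <= excess K y.
Proof.
move=> /natrP[a ->] /natrP[c ->]; rewrite !excess_nat !ler_nat; exact: leq_sub2r.
Qed.

(** Above [K] the factor [(x / K) `^ (r - 1)] is at least 1. *)
Lemma excess_le K x r : (0 < K)%N -> 1 <= r -> x \is a Num.nat ->
  excess K x <= (K%:R `^ (r - 1))^-1 * x `^ r.
Proof.
move=> K0 r1 /natrP[a ->]; rewrite excess_nat.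
have [aK|Ka] := leqP a K.
  by rewrite (eqP aK) mulr_ge0 ?invr_ge0 ?powR_ge0.
have K0' : 0 < K%:R :> R by rewrite ltr0n.
rewrite mulrC ler_pdivlMr ?powR_gt0// -(@mulr_powRB1 _ a%:R r)//; last lra.
rewrite ler_pM ?powR_ge0// ?ler_nat ?leq_subr//.
by rewrite ge0_ler_powR ?nnegrE ?ler_nat//; [lra | exact: ltnW].
Qed.

(** Cauchy condensation: the [2 ^ m] terms starting at index [2 ^ m] are each at
    most [2 ^+ m `^ (- s)], so that the dyadic blocks form a geometric series. *)
Lemma sum_powRN_le K (s : R) : 1 < s ->
  \sum_(k < K) k.+1%:R `^ (- s) <= (1 - 2 `^ (1 - s))^-1 :> R.
Proof.
move=> s1; pose th : R := 2 `^ (1 - s).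
have th1 : th < 1.
  by rewrite /th /powR pnatr_eq0/= expR_lt1 pmulr_llt0 ?ln_gt0 ?ltr1n// subr_lt0.
have cond m : \sum_(1 <= k < 2 ^ m) k%:R `^ (- s) <= \sum_(i < m) th ^+ i.
  elim: m => [|m IH]; first by rewrite big_ord0 expn0 big_geq.
  rewrite (@big_cat_nat _ _ _ (2 ^ m))/=; last 2 first.
  - by rewrite expn_gt0.
  - by rewrite leq_exp2l.
  rewrite big_ord_recr/= lerD//.
  apply: (@le_trans _ _ (\sum_(2 ^ m <= k < 2 ^ m.+1) (2 ^+ m) `^ (- s))).
    rewrite big_nat_cond [leRHS]big_nat_cond; apply: ler_sum => k /andP[/andP[mk _] _].
    have e0 : 0 < 2 ^+ m :> R by rewrite exprn_gt0.
    have k2 : 2 ^+ m <= k%:R :> R by rewrite -natrX ler_nat.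
    rewrite !powRN lef_pV2 ?posrE ?powR_gt0//; last exact: lt_le_trans k2.
    by rewrite ge0_ler_powR ?nnegrE ?(ltW e0)//; lra.
  rewrite sumr_const_nat expnS mul2n -addnn addnK -[_ *+ _]mulr_natl natrX.
  rewrite /th -!powR_mulrn ?powR_ge0// -!powRrM -powRD ?pnatr_eq0 ?implybT//.
  by rewrite le_eqVlt; apply/orP; left; apply/eqP; congr (_ `^ _); ring.
apply: le_trans (geometric_sum_le K (powR_ge0 2 _) th1).
apply: le_trans (cond K).
rewrite -(big_mkord xpredT (fun k => k.+1%:R `^ (- s))).
rewrite (@big_cat_nat _ _ _ K.+1 1 (2 ^ K))//=; last exact: ltn_expl.
by rewrite big_add1/= lerDl sumr_ge0// => k _; exact: powR_ge0.
Qed.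

End excess.

Section process_moments.
Context {R : realType} {d : measure_display} {T : measurableType d}.
Context (P : probability T R) (N : \bar R -> {RV P >-> R}).
Hypothesis cN : counting_process N.
Variables (r M : R).
Hypotheses (r1 : 1 <= r) (M0 : 0 < M).
Hypothesis rM : mean_le P (fun w => N +oo%E w `^ r) M.

Lemma counting_le_infty (t : R) w : 0 <= t -> N t%:E w <= N +oo%E w.
Proof. by move=> t0; apply: (counting_nondecreasing cN); rewrite ?lee_fin ?leey. Qed.

Lemma counting_natE (t : \bar R) w : (0 <= t)%E -> N t w \is a Num.nat.
Proof. exact: counting_nat. Qed.

(** Markov's inequality at the terminal value; it makes the [p]-th roots of the
    level probabilities summable over [k] as soon as [p < r]. *)
Lemma level_prob_markov k (t : R) : 0 <= t ->
  path_prob N (level k t) <= M / k.+1%:R `^ r.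
Proof.
move=> t0; have kr : 0 < k.+1%:R `^ r :> R by rewrite powR_gt0.
rewrite ler_pdivlMr// -lee_fin mulrC EFinM -path_probE; last exact: level_measurable.
have mE := measurable_path N (level_measurable k t0).
have [_ _ +] := rM; apply: le_trans.
rewrite -[X in P X]setIT -integral_indic// -ge0_integralZl//;
  try (by apply/measurable_EFinP; exact: measurable_indic);
  try by rewrite lee_fin ltW.
apply: ge0_le_integral => //.
- by apply/measurable_EFinP; apply: measurable_funM => //; exact: measurable_indic.
- by apply/measurable_EFinP; case: rM.
move=> w _; rewrite -EFinM lee_fin indicE.
have [/set_mem h|_] := boolP (w \in _); last by rewrite mulr0 powR_ge0.
have hk : k.+1%:R <= N +oo%E w := le_trans h (counting_le_infty w t0).
rewrite mulr1 ge0_ler_powR ?nnegrE//; first exact: le_trans r1.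
exact: le_trans hk.
Qed.

Variable K : nat.
Hypothesis K0 : (0 < K)%N.

Let measurable_excess (t : R) : 0 <= t -> measurable_fun setT (fun w => excess K (N t%:E w)).
Proof.
move=> t0; apply: measurable_funB => //.
apply: measurable_sum => k.
rewrite (_ : (fun _ => _) = \1_(path_of N @^-1` level k t)); last first.
  by apply/funext => w; rewrite indicE; congr ((_ : bool)%:R); apply/idP/idP; rewrite inE.
by apply: measurable_indic; apply: measurable_path; exact: level_measurable.
Qed.

Lemma excess_counting_le (t : R) w : 0 <= t ->
  excess K (N t%:E w) <= (K%:R `^ (r - 1))^-1 * N +oo%E w `^ r.
Proof.
move=> t0; have n1 := counting_natE w (t := t%:E); rewrite lee_fin in n1.
have n2 := counting_natE w (t := +oo%E) (leey _).
apply: le_trans (excess_le K0 r1 n2).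
exact: (excess_nd K (n1 t0) n2 (counting_le_infty w t0)).
Qed.

Lemma mean_excess (t : R) : 0 <= t ->
  mean_le P (fun w => excess K (N t%:E w)) ((K%:R `^ (r - 1))^-1 * M).
Proof.
move=> t0; have n1 w := @counting_natE t%:E w.
apply: mean_le_dom (mean_leZ _ rM) => //.
- exact: measurable_excess.
- move=> w; rewrite excess_counting_le// andbT excess_ge0// n1// lee_fin.
Qed.

Definition mean_tail (t : R) : R := fine (\int[P]_w (excess K (N t%:E w))%:E).

Let mean_tailE (t : R) : 0 <= t ->
  (\int[P]_w (excess K (N t%:E w))%:E = (mean_tail t)%:E)%E.
Proof.
move=> t0; have [_ h0 hM] := mean_excess t0.
rewrite fineK// ge0_fin_numE; first by apply: le_lt_trans hM _; rewrite ltry.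
by apply: integral_ge0 => w _; rewrite lee_fin.
Qed.

Lemma mean_tail_ge0 t : 0 <= t -> 0 <= mean_tail t.
Proof.
move=> t0; rewrite -lee_fin -mean_tailE//; have [_ h0 _] := mean_excess t0.
by apply: integral_ge0 => w _; rewrite lee_fin.
Qed.

Lemma mean_tail_le t : 0 <= t -> mean_tail t <= (K%:R `^ (r - 1))^-1 * M.
Proof. by move=> t0; rewrite -lee_fin -mean_tailE//; have [] := mean_excess t0. Qed.

Lemma mean_tail_nd s t : 0 <= s -> s <= t -> mean_tail s <= mean_tail t.
Proof.
move=> s0 st; have t0 : 0 <= t by exact: le_trans st.
have [ms es _] := mean_excess s0; have [mt et _] := mean_excess t0.
rewrite -lee_fin -!mean_tailE//; apply: ge0_le_integral => //.
- by move=> w _; rewrite lee_fin.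
- exact/measurable_EFinP.
- exact/measurable_EFinP.
- move=> w _; rewrite lee_fin; apply: excess_nd; rewrite ?counting_natE ?lee_fin//.
  by apply: (counting_nondecreasing cN); rewrite lee_fin.
Qed.

Lemma mean_function_split (t : R) : 0 <= t ->
  mean_function N t%:E = \sum_(k < K) path_prob N (level k t) + mean_tail t.
Proof.
move=> t0; rewrite /mean_function unlock.
have [me e0 _] := mean_excess t0.
have mI k : measurable (path_of N @^-1` level k t).
  by apply: measurable_path; exact: level_measurable.
have -> : (\int[P]_w (N t%:E w)%:E = \int[P]_w
    (\sum_(k < K) (\1_(path_of N @^-1` level k t) w)%:E + (excess K (N t%:E w))%:E))%E.
  apply: eq_integral => w _; rewrite sumEFin -EFinD; congr EFin.
  rewrite /excess addrC -[LHS](subrK (\sum_(k < K) (k.+1%:R <= N t%:E w)%R%:R)); congr (_ + _).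
  apply: eq_bigr => k _; rewrite indicE; congr ((_ : bool)%:R).
  by apply/idP/idP; rewrite inE.
rewrite ge0_integralD//; last 4 first.
- by move=> w _; apply: sume_ge0 => k _; rewrite lee_fin.
- by apply: emeasurable_sum => k; apply/measurable_EFinP; exact: measurable_indic.
- by move=> w _; rewrite lee_fin.
- exact/measurable_EFinP.
rewrite mean_tailE// ge0_integral_sum//; last first.
  by move=> k; apply/measurable_EFinP; exact: measurable_indic.
rewrite (eq_bigr (fun k : 'I_K => (path_prob N (level k t))%:E)); last first.
  move=> k _; rewrite integral_indic// setIT; apply: path_probE.
  exact: level_measurable.
by rewrite sumEFin.
Qed.

End process_moments.

(** * Summing over the levels *)

Section main_bound.
Context {R : realType} (p : R).
Context {d0 : measure_display} {T0 : measurableType d0} (P0 : probability T0 R)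
  (N : \bar R -> {RV P0 >-> R}).
Context {d : measure_display} {T : measurableType d} (P : probability T R).
Context (n : nat) (Ns : 'I_n -> \bar R -> {RV P >-> R}).
Hypotheses (cN : counting_process N) (cNs : forall i, counting_process (Ns i)).
Hypothesis sd : forall i, same_distribution (Ns i) N.
Hypothesis indep : independent_processes Ns.
Hypotheses (p1 : 1 <= p) (p2 : p < 2) (n0 : (0 < n)%N).
Variables (r M : R).
Hypotheses (pr : p < r) (M0 : 0 < M).
Hypothesis rM : mean_le P0 (fun w => N +oo%E w `^ r) M.
Hypothesis rMs : forall i, mean_le P (fun w => Ns i +oo%E w `^ r) M.

(** The sum over the chaining depths: 76 is the constant of one link, 218 that of
    the part below the finest cells. *)
Definition level_const : R := 218 + 76 / (1 - 2 `^ (2^-1 - p^-1)).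

(** The levels contribute the sum over [k] of [(M / k.+1 `^ r) `^ p^-1], and the part
    above the truncation level contributes [2 * M]. *)
Definition total_const : R :=
  level_const * M `^ p^-1 * (1 - 2 `^ (1 - r / p))^-1 + 2 * M.

Let centered (t : R) (w : T) : R :=
  n%:R * (average Ns t%:E w - mean_function N t%:E).

Let n0R : 0 < n%:R :> R. Proof. by rewrite ltr0n. Qed.

Let p0 : 0 < p. Proof. exact: lt_le_trans p1. Qed.

Let r1 : 1 < r. Proof. exact: le_lt_trans p1 pr. Qed.

Section truncated.
Variable K : nat.
Hypothesis K0 : (0 < K)%N.

Let cK : R := (K%:R `^ (r - 1))^-1.

Let cK0 : 0 < cK. Proof. by rewrite invr_gt0 powR_gt0// ltr0n. Qed.

Let tail (t : R) (w : T) : R :=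
  \sum_(i < n) excess K (Ns i t%:E w) - n%:R * mean_tail N K t.

Let centered_split (t : R) w : 0 <= t ->
  centered t w = \sum_(k < K) dev N Ns k t w + tail t w.
Proof.
move=> t0; rewrite /centered /average mulrBr mulrA mulfV ?gt_eqF// mul1r.
rewrite (mean_function_split cN (ltW r1) rM K0 t0) mulrDr /tail /dev.
rewrite sumrB -mulr_sumr.
have -> : \sum_(i < n) Ns i t%:E w = \sum_(k < K) (count_in Ns (level k t) w)%:R
    + \sum_(i < n) excess K (Ns i t%:E w).
  under [in RHS]eq_bigr do rewrite natr_sum.
  rewrite exchange_big/= -big_split/=; apply: eq_bigr => i _.
  rewrite /excess addrC -[LHS](subrK (\sum_(k < K) (k.+1%:R <= Ns i t%:E w)%R%:R)).
  congr (_ + _); apply: eq_bigr => k _; congr ((_ : bool)%:R).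
  by apply/idP/idP; rewrite inE.
ring.
Qed.

Let tail_bound (w : T) : R :=
  \sum_(i < n) cK * Ns i +oo%E w `^ r + n%:R * (cK * M).

Let pvar_tail w : pvar_le p (tail ^~ w) (tail_bound w).
Proof.
have sum0 : 0 <= \sum_(i < n) cK * Ns i +oo%E w `^ r.
  by apply: sumr_ge0 => i _; rewrite mulr_ge0 ?powR_ge0// ltW.
pose u t := \sum_(i < n) excess K (Ns i t%:E w) + n%:R * mean_tail N K t.
have cnat i (t : R) : 0 <= t -> Ns i t%:E w \is a Num.nat.
  by move=> t0; apply: (counting_nat (cNs i)); rewrite lee_fin.
have e_nd (s t : R) : 0 <= s -> s <= t ->
    \sum_(i < n) excess K (Ns i s%:E w) <= \sum_(i < n) excess K (Ns i t%:E w).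
  move=> s0 st; apply: ler_sum => i _; apply: excess_nd.
  - exact: cnat.
  - by apply: cnat; exact: le_trans st.
  - by apply: (counting_nondecreasing (cNs i)); rewrite lee_fin.
have m_nd (s t : R) : 0 <= s -> s <= t ->
    n%:R * mean_tail N K s <= n%:R * mean_tail N K t.
  by move=> s0 st; rewrite ler_wpM2l// (mean_tail_nd cN (ltW r1) rM K0).
apply: (@pvar_le_monotone _ p p1 _ u).
- by rewrite ltr_wpDl// !mulr_gt0.
- move=> s t s0 st; have h1 := e_nd _ _ s0 st; have h2 := m_nd _ _ s0 st.
  by rewrite /tail /u ler_norml; apply/andP; split; lra.
- move=> s t s0 st; have t0 : 0 <= t by exact: le_trans st.
  have us : 0 <= u s.
    rewrite /u addr_ge0//; last first.
      by rewrite mulr_ge0// (mean_tail_ge0 cN (ltW r1) rM K0).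
    by apply: sumr_ge0 => i _; rewrite excess_ge0// cnat.
  have ut : u t <= tail_bound w.
    rewrite /u /tail_bound lerD//.
      apply: ler_sum => i _; exact: (excess_counting_le (cNs i) (ltW r1) K0).
    by rewrite ler_wpM2l// (mean_tail_le cN (ltW r1) rM K0).
  lra.
Qed.

Let mean_tail_bound : mean_le P tail_bound (n%:R * (cK * M) + n%:R * (cK * M)).
Proof.
apply: mean_leD; last by apply: mean_le_cst; rewrite !mulr_ge0// ltW.
(* The copies, extended by 0 to all natural indices. *)
pose g i w : R := if insub i is Some i' then cK * Ns i' +oo%E w `^ r else 0.
have -> : (fun w => \sum_(i < n) cK * Ns i +oo%E w `^ r) =
          (fun w => \sum_(i < n) g i w).
  by apply/funext => w; apply: eq_bigr => i _; rewrite /g valK.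
have -> : n%:R * (cK * M) = \sum_(i < n) cK * M.
  by rewrite sumr_const card_ord mulr_natl.
apply: (mean_le_sum (g := g) (a := fun=> cK * M)) => i ni.
rewrite /g insubT; apply: mean_leZ => //; exact: ltW.
Qed.

(** Below [K] the process is a sum of one-jump processes, to which [jump_bound]
    applies with the Markov bound for their probabilities. Above [K] the total
    variation is small: its mean is [2 * n * M / K `^ (r - 1)], hence at most
    [2 * M] by the choice of [K]. *)
Lemma centered_bound_truncated : n%:R <= K%:R `^ (r - 1) ->
  exists A : T -> R, (forall w, pvar_le p (centered ^~ w) (A w)) /\
  mean_le P A (n%:R `^ p^-1 * total_const).
Proof.
move=> nK.
pose q k : R := M / k.+1%:R `^ r.
have q0 k : 0 < q k by rewrite divr_gt0// powR_gt0.
have /choice[A HA] : forall k, exists A : T -> R,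
    (forall w, pvar_le p (fun t => dev N Ns k t w) (A w)) /\
    mean_le P A (level_const * (n%:R * q k) `^ p^-1).
  move=> k; apply: (jump_bound cN cNs sd indep p1 p2 n0 (q0 k)) => t t0.
  exact: (level_prob_markov cN (ltW r1) rM).
exists (fun w => \sum_(k < K) A k w + tail_bound w); split.
  move=> w.
  apply: (@pvar_le_ext _ p (fun t => \sum_(k < K) dev N Ns k t w + tail t w)).
    by move=> t t0; rewrite centered_split.
  apply: (@pvar_le_big _ p p1 K (fun k t => dev N Ns k t w) (fun k => A k w)).
    exact: pvar_tail.
  by move=> k _; have [H _] := HA k.
have mA : mean_le P (fun w => \sum_(k < K) A k w)
    (\sum_(k < K) level_const * (n%:R * q k) `^ p^-1).
  apply: (mean_le_sum (g := A) (a := fun k => level_const * (n%:R * q k) `^ p^-1)).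
  by move=> k _; have [_ H] := HA k.
apply: mean_leW (mean_leD mA mean_tail_bound).
have C0 : 0 <= level_const.
  rewrite /level_const addr_ge0// divr_ge0// subr_ge0.
  rewrite /powR pnatr_eq0/= -[leRHS]expR0 ler_expR pmulr_lle0 ?ln_gt0 ?ltr1n//.
  by rewrite subr_le0 lef_pV2 ?posrE// ltW.
have np1 : 1 <= n%:R `^ p^-1 :> R.
  by rewrite -[leLHS](powRr0 n%:R) ler_powR ?ler1n// invr_ge0 ltW.
have h1 : \sum_(k < K) level_const * (n%:R * q k) `^ p^-1 <=
    n%:R `^ p^-1 * (level_const * M `^ p^-1 * (1 - 2 `^ (1 - r / p))^-1).
  have -> : n%:R `^ p^-1 * (level_const * M `^ p^-1 * (1 - 2 `^ (1 - r / p))^-1) =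
    (level_const * (n%:R `^ p^-1 * M `^ p^-1)) * (1 - 2 `^ (1 - r / p))^-1 by ring.
  have -> : \sum_(k < K) level_const * (n%:R * q k) `^ p^-1 =
    (level_const * (n%:R `^ p^-1 * M `^ p^-1)) *
      \sum_(k < K) k.+1%:R `^ (- (r / p)).
    rewrite mulr_sumr; apply: eq_bigr => k _; rewrite -!mulrA; congr (_ * _).
    have z0 : 0 <= (k.+1%:R `^ r)^-1 :> R by rewrite invr_ge0 powR_ge0.
    rewrite /q mulrA (powRM _ _ z0) ?mulr_ge0 ?(ltW M0)//.
    rewrite powRM ?(ltW M0)// -mulrA; congr (_ * (_ * _)).
    by rewrite -powRN -powRrM mulNr.
  rewrite ler_wpM2l ?mulr_ge0 ?powR_ge0//; apply: sum_powRN_le.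
  by rewrite ltr_pdivlMr// mul1r.
have h2 : n%:R * (cK * M) <= M.
  rewrite mulrA ler_piMl ?(ltW M0)// /cK ler_pdivrMr ?mul1r//.
  by rewrite powR_gt0// ltr0n.
have h3 : 2 * M <= n%:R `^ p^-1 * (2 * M) by rewrite ler_peMl// mulr_ge0// ltW.
rewrite /total_const mulrDr; lra.
Qed.

End truncated.

(** The truncation level is chosen according to [n], large enough for the tail to
    contribute a constant; dividing by [n] turns [n `^ p^-1] into the rate. *)
Lemma pvar_norm_bound :
  (\int[P]_w pvar_norm p (fun t : R => (average Ns t%:E w - mean_function N t%:E)%R)
     <= (2 * total_const * n%:R `^ ((1 - p) / p))%:E)%E.
Proof.
pose y : R := n%:R `^ (r - 1)^-1.
have rm0 : 0 < r - 1 by rewrite subr_gt0.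
have yK : n%:R <= (Num.truncn y).+1%:R `^ (r - 1) :> R.
  have -> : n%:R = y `^ (r - 1) by rewrite /y -powRrM mulVf ?gt_eqF// powRr1.
  rewrite ge0_ler_powR ?nnegrE ?powR_ge0 ?(ltW rm0)//.
  by rewrite ltW// truncnS_gt.
have [A [pA mA]] := centered_bound_truncated (ltn0Sn _) yK.
have [_ A0 _] := mA.
pose B w : R := 2 * (n%:R^-1 * A w).
have pB w : pvar_le p (fun t : R => average Ns t%:E w - mean_function N t%:E)
    (n%:R^-1 * A w).
  have ni0 : 0 < n%:R^-1 :> R by rewrite invr_gt0.
  apply: pvar_le_ext (pvar_le_scale ni0 (pA w)) => t _.
  by rewrite /centered mulrA mulVf ?mul1r// gt_eqF.
have f00 w : average Ns 0%:E w - mean_function N 0%:E = 0.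
  rewrite /average big1 ?mulr0; last by move=> i _; exact: (counting0 (cNs i)).
  rewrite /mean_function unlock (_ : (fun _ => _) = cst 0%E) ?integral0 ?subr0//.
  by apply/funext => w0; rewrite /= (counting0 cN).
have mB : mean_le P B (2 * total_const * n%:R `^ ((1 - p) / p)).
  have h : mean_le P B (2 * (n%:R^-1 * (n%:R `^ p^-1 * total_const))).
    by do 2! [apply: mean_leZ; first by rewrite ?invr_ge0].
  apply: mean_leW h; rewrite mulrBl mulfV ?gt_eqF// mul1r powRB; last first.
    by rewrite pnatr_eq0 -lt0n n0 implybT.
  rewrite powRr1//; lra.
apply: le_integral_dominated mB.
- move=> w; rewrite /pvar_norm /pvar_seminorm adde_ge0 ?poweR_ge0//.
  apply: le_trans (ereal_sup_ubound _); last by exists 0 => //=.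
  by rewrite lee_fin.
- by move=> w; apply: pvar_norm_le.
Qed.

End main_bound.

(** Only the law of the terminal value enters: this is what makes the constant
    uniform over all processes sharing it. *)
Lemma mean_le_distribution (R : realType) (mu : probability R R) (r M : R)
    (d : measure_display) (T : measurableType d) (P : probability T R)
    (X : {RV P >-> R}) :
  (forall B : set R, measurable B -> distribution P X B = mu B) ->
  (\int[mu]_x (x `^ r)%:E <= M%:E)%E -> mean_le P (fun w => X w `^ r) M.
Proof.
move=> Xmu muM; split.
- by apply: (measurableT_comp (measurable_powR r)).
- by move=> w; exact: powR_ge0.
- apply: le_trans muM.
  rewrite (@eq_measure_integral _ _ _ setT (distribution P X) mu); last first.
    by move=> B mB _; apply/esym; exact: Xmu.
  rewrite ge0_integral_distribution//.
  + by apply/measurable_EFinP; exact: measurable_powR.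
  + by move=> y; rewrite lee_fin powR_ge0.
Qed.

Theorem theorem3 (R : realType) (p : R) (hp : 1 <= p < 2)
    (mu : probability R R) :
  exists C : R,
  forall (d0 : measure_display) (T0 : measurableType d0)
    (P0 : probability T0 R) (N : \bar R -> {RV P0 >-> R}),
  counting_process N ->
  (forall B : set R, measurable B -> distribution P0 (N +oo%E) B = mu B) ->
  (exists eps : R, 0 < eps /\
     ('E_P0[fun w => (N +oo%E w `^ (p + eps))%R] < +oo)%E) ->
  forall n : nat, (0 < n)%N ->
  forall (d : measure_display) (T : measurableType d) (P : probability T R)
    (Ns : 'I_n -> \bar R -> {RV P >-> R}),
  (forall i, counting_process (Ns i)) ->
  (forall i, same_distribution (Ns i) N) ->
  independent_processes Ns ->
  (\int[P]_w pvar_norm p (fun t : R => (average Ns t%:E w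
                                        - mean_function N t%:E)%R)
     <= (C * n%:R `^ ((1 - p) / p))%:E)%E.
Proof.
have [p1 p2] := andP hp.
(* The exponent is selected from [mu] alone, before any process is given. *)
have [[eps [eps0 fin]]|no] := pselect (exists eps : R, 0 < eps /\
    (\int[mu]_x (x `^ (p + eps))%:E < +oo)%E); last first.
  exists 0 => d0 T0 P0 N cN Nmu [eps [eps0 fin]]; case: no; exists eps; split=> //.
  rewrite (@eq_measure_integral _ _ _ setT (distribution P0 (N +oo%E)) mu); last first.
    by move=> B mB _; apply/esym; exact: Nmu.
  rewrite ge0_integral_distribution//.
  + by move: fin; rewrite unlock.
  + by apply/measurable_EFinP; exact: measurable_powR.
  + by move=> x; rewrite lee_fin powR_ge0.
have I0 : (0 <= \int[mu]_x (x `^ (p + eps))%:E)%E.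
  by apply: integral_ge0 => x _; rewrite lee_fin powR_ge0.
pose M : R := 1 + fine (\int[mu]_x (x `^ (p + eps))%:E)%E.
have M0 : 0 < M by rewrite ltr_wpDr// fine_ge0.
have IM : (\int[mu]_x (x `^ (p + eps))%:E <= M%:E)%E.
  by rewrite -[leLHS]fineK ?ge0_fin_numE// lee_fin lerDr.
exists (2 * total_const p (p + eps) M).
move=> d0 T0 P0 N cN Nmu _ n n0 d T P Ns cNs sd indep.
have Nsmu i (B : set R) : measurable B -> distribution P (Ns i +oo%E) B = mu B.
  move=> mB; rewrite -(Nmu _ mB).
  exact: (sd i _ (path_measurable_coord (leey _) mB)).
have pr : p < p + eps by rewrite ltrDl.
apply: (pvar_norm_bound cN cNs sd indep p1 p2 n0 pr M0).
  exact: mean_le_distribution Nmu IM.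
by move=> i; exact: mean_le_distribution (Nsmu i) IM.
Qed.
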